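(* Let $q$ be a prime power and let $T,U,V,W$ be four distinct points of the line $\ell_\infty$ of $\mathrm{PG}(2,q^3)$ not all contained in a common order-$q$-subline. Then there is a unique tangent splash of $\ell_\infty$ with centre $T$ containing $T,U,V,W$.
   Context: An order-$q$-subplane of $\mathrm{PG}(2,q^3)$ is a subplane of order $q$. An order-$q$-subline of a line is an image of $\mathrm{PG}(1,q)$ under $\mathrm{PGL}(2,q^3)$. If $\pi$ is an order-$q$-subplane meeting $\ell_\infty$ in exactly one point $T$, its tangent splash is the set of $q^2+1$ points of $\ell_\infty$ lying on the extension of some line of $\pi$; $T$ is its centre. A tangent splash with centre $T$ is any set arising this way. *)

(* Defs.v *)
From HB Require Import structures.
From mathcomp Require Import all_boot all_order all_fingroup all_algebra all_field.

Set Implicit Arguments.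
Unset Strict Implicit.
Unset Printing Implicit Defensive.

Import GRing.Theory.

Local Open Scope ring_scope.

(* The d-dimensional linear subspaces of F^n, each represented by the unique
   matrix A in canonical form (<<A>> = A) having it as row space, so that
   Leibniz equality is equality of subspaces and the type is finite. *)
Record subspace (F : finFieldType) (n d : nat) := Subspace {
  subspace_mx :> 'M[F]_n;
  _ : (<<subspace_mx>>%MS == subspace_mx) && (\rank subspace_mx == d)
}.

HB.instance Definition _ (F : finFieldType) (n d : nat) :=
  [isSub for @subspace_mx F n d].
HB.instance Definition _ (F : finFieldType) (n d : nat) :=
  [Finite of subspace F n d by <:].

(* subspace F 2 1 : points of PG(1,F); point F, line F : those of PG(2,F). *)
Notation point F := (subspace F 3 1).
Notation line F := (subspace F 3 2).

Definition incident (F : finFieldType) (X : point F) (m : line F) : bool :=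
  (X <= m)%MS.

(* The points of P and the lines of L form, under the incidence induced by I,
   a projective plane of order q. *)
Record projective_plane (pT lT : finType) (I : pT -> lT -> bool)
    (P : {set pT}) (L : {set lT}) (q : nat) : Prop := ProjectivePlane {
  pp_join : forall X Y, X \in P -> Y \in P -> X != Y ->
    exists! m, [/\ m \in L, I X m & I Y m];
  pp_meet : forall m n, m \in L -> n \in L -> m != n ->
    exists! X, [/\ X \in P, I X m & I X n];
  pp_quadrangle : exists Q : {set pT}, [/\ Q \subset P, #|Q| = 4%N &
    forall m, m \in L -> (#|[set X in Q | I X m]| <= 2)%N];
  pp_order : forall m, m \in L -> #|[set X in P | I X m]| = q.+1
}.

Definition subplane (F : finFieldType) (q : nat)
    (P : {set point F}) (L : {set line F}) : Prop :=
  projective_plane (@incident F) P L q.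

Definition tangent_splash (F : finFieldType) (q : nat) (l : line F)
    (T : point F) (S : {set point F}) : Prop :=
  exists (P : {set point F}) (L : {set line F}),
    [/\ subplane q P L,
        [set X in P | incident X l] = [set T] &
        S = [set X : point F | incident X l & [exists m in L, incident X m]]].

Definition subfield_of_order (F : finFieldType) (q : nat) (K : {set F}) : Prop :=
  divring_closed K /\ #|K| = q.

(* The copy of PG(1,K) in PG(1,F): points with homogeneous coordinates in K. *)
Definition PG1 (F : finFieldType) (K : {set F}) : {set subspace F 2 1} :=
  [set X : subspace F 2 1 | [exists v : 'rV[F]_2,
     [&& v != 0, [forall i, v 0 i \in K] & (X == v)%MS]]].

(* The image of a set of points under the map <v> |-> <v *m M>; M is only used
   with linearly independent rows. *)
Definition proj_image (F : finFieldType) (m n : nat) (M : 'M[F]_(m, n))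
    (S : {set subspace F m 1}) : {set subspace F n 1} :=
  [set Y : subspace F n 1 | [exists X in S, (Y == X *m M)%MS]].

Definition subline_PG1 (F : finFieldType) (q : nat)
    (S : {set subspace F 2 1}) : Prop :=
  exists (K : {set F}) (g : 'M[F]_2),
    [/\ subfield_of_order q K, g \in unitmx & S = proj_image g (PG1 K)].

(* A basis B of the plane l of F^3 identifies PG(1,F) with the line l; another
   basis changes the identification by an element of PGL(2,F) only. *)
Definition subline (F : finFieldType) (q : nat) (l : line F)
    (S : {set point F}) : Prop :=
  exists (B : 'M[F]_(2, 3)) (S1 : {set subspace F 2 1}),
    [/\ (B == l)%MS, subline_PG1 q S1 & S = proj_image B S1].

(* Main.v *)
(* Let K be the subfield of order q.  A subplane of order q contains a
   quadrangle, and in coordinates with respect to a quadrangle its points and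
   lines are exactly those with coordinates in K: the sets of coordinate triples
   of points and of lines are closed under cross products, which encode join and
   meet, so that the usual ruler constructions make {a | (1 : a : 0) is a point}
   a subfield, of order q by counting the points of one line.
   Taking T as a vertex of the quadrangle and an affine coordinate on l with T at
   infinity, a line of the subplane other than those through T meets l in a point
   of coordinate be + ga * (k1 + k2 * th), with k1, k2 in K.  Hence the tangent
   splashes with centre T are {T} together with the affine K-planes of F, while
   T, U, V, W are not on a common subline iff the affine coordinates of U, V, W are
   not K-collinear, in which case they span a unique K-plane. *)

Require Import Defs.
From mathcomp Require Import all_boot all_order all_fingroup all_algebra.
From mathcomp Require Import all_field ring.

Set Implicit Arguments.
Unset Strict Implicit.
Unset Printing Implicit Defensive.

Import GRing.Theory.
Local Open Scope ring_scope.

(** * The subfield of order q *)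

Section SubfieldClosed.
Variables (F : finFieldType) (q : nat) (K : {set F}).
Hypothesis Kq : subfield_of_order q K.
Implicit Types x y : F.

Lemma subfield1 : 1 \in K. Proof. by case: Kq => -[]. Qed.

Lemma subfieldB x y : x \in K -> y \in K -> x - y \in K.
Proof. by case: Kq => -[_ KB _] _; apply: KB. Qed.

Lemma subfield_div x y : x \in K -> y \in K -> x / y \in K.
Proof. by case: Kq => -[_ _ Kd] _; apply: Kd. Qed.

Lemma subfield0 : 0 \in K.
Proof. by rewrite -(subrr 1) subfieldB ?subfield1. Qed.

Lemma subfieldN x : x \in K -> - x \in K.
Proof. by rewrite -sub0r; apply/subfieldB/subfield0. Qed.

Lemma subfieldD x y : x \in K -> y \in K -> x + y \in K.
Proof. by move=> xK /subfieldN yK; rewrite -(opprK y) subfieldB. Qed.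

Lemma subfieldM x y : x \in K -> y \in K -> x * y \in K.
Proof.
by move=> xK yK; rewrite -(invrK y) -(mul1r y^-1) !subfield_div ?subfield1.
Qed.

End SubfieldClosed.

Section SubfieldOfOrder.
Variables (F : finFieldType) (q : nat).
Hypothesis q_pp : exists p k : nat, [/\ prime p, (0 < k)%N & q = (p ^ k)%N].
Hypothesis cardF : #|F| = (q ^ 3)%N.

Definition frob_fixed : {set F} := [set x | x ^+ q == x].

Lemma order_gt1 : (1 < q)%N.
Proof.
case: q_pp => p [k [p_pr k_gt0 ->]].
by rewrite -(exp1n k) ltn_exp2r // prime_gt1.
Qed.

(** The order of [F] is a power of [p], so this map is an iterate of the Frobenius map. The ring [R]
    is general so that the identity also applies to [{poly F}]. *)
Lemma expq_pchar (R : comNzRingType) : [pchar R] =i [pchar F] ->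
  {morph (fun x : R => x ^+ q) : x y / x - y}.
Proof.
case: q_pp => p [k [p_pr k_gt0 qE]] charR x y.
have charp : p \in [pchar R].
  by rewrite charR; apply: (@card_finPcharP F p (k * 3)); rewrite // cardF qE expnM.
rewrite qE; elim: k {k_gt0 qE} x y => [|k IH] x y; first by rewrite !expr1.
by rewrite expnS !exprM -!(pFrobenius_autE charp) rmorphB /= IH.
Qed.

Lemma frob_fixed_divring : divring_closed frob_fixed.
Proof.
split=> [|x y|x y]; rewrite !inE ?expr1n // => /eqP xK /eqP yK.
  by rewrite expq_pchar // xK yK.
by rewrite exprMn exprVn xK yK.
Qed.

(** [X^q - X] divides [X^(q^3) - X], the product of all [X - x]; hence it splits into distinct
    linear factors and has exactly [q] roots. *)
Lemma card_frob_fixed : #|frob_fixed| = q.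
Proof.
have q1 := order_gt1.
have szq : size ('X^q - 'X : {poly F}) = q.+1.
  by rewrite size_polyDl ?size_polyXn // size_polyN size_polyX.
have dvdF : ('X^q - 'X : {poly F}) %| \prod_(x : F) ('X - x%:P).
  have e (u v : {poly F}) : (u - v) ^+ q = u ^+ q - v ^+ q.
    by apply: expq_pchar; exact: pchar_poly.
  rewrite -finField_genPoly cardF.
  (* With [f = X^q - X], the sum [f^(q^2) + f^q + f] telescopes, because the power [q] respects
     differences. *)
  have -> : ('X^(q ^ 3) - 'X : {poly F}) =
      ('X^q - 'X) ^+ q ^+ q + ('X^q - 'X) ^+ q + ('X^q - 'X).
    by rewrite !e -!exprM !expnS expn0 muln1 mulnA; ring.
  have qq := ltnW q1.
  by rewrite dvdp_add // dvdp_add // ?dvdp_exp.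
(* Up to a scalar, a divisor of a product of factors [X - x] is the product over a sublist of the
   [x]. *)
have [m mE] := dvdp_prod_XsubC dvdF.
have sz := eqp_size mE; rewrite szq size_prod_XsubC in sz.
case: sz => szm; rewrite [RHS]szm.
have /card_uniqP <- : uniq (mask m (index_enum F)).
  by rewrite mask_uniq ?index_enum_uniq.
apply: eq_card => x; rewrite inE.
rewrite -root_prod_XsubC -(eqp_root mE).
by rewrite rootE !hornerE subr_eq0.
Qed.

Lemma subfield_order_frob_fixed : subfield_of_order q frob_fixed.
Proof. by split; [exact: frob_fixed_divring|exact: card_frob_fixed]. Qed.

(** Both sets have [q] elements, so one inclusion suffices. Multiplication by a nonzero [x] of [K]
    permutes the nonzero elements of [K]; comparing their products gives [x^(q-1) = 1]. *)
Lemma subfield_frob_fixed (K : {set F}) :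
  subfield_of_order q K -> K = frob_fixed.
Proof.
move=> Kq; have [_ cardK] := Kq; apply/eqP.
rewrite eqEcard card_frob_fixed cardK leqnn andbT.
have q1 := order_gt1.
apply/subsetP => x xK; rewrite inE.
have [->|x0] := eqVneq x 0; first by rewrite expr0n -[q]prednK // ltnW.
have prod_neq0 : \prod_(y in K :\ 0) y != 0.
  by apply/prodf_neq0 => y; rewrite !inE => /andP[].
have : \prod_(y in K :\ 0) y = \prod_(y in K :\ 0) (y * x).
  rewrite [LHS](reindex_onto (fun y => y * x) (fun y => y / x)) /=; last first.
    by move=> y _; rewrite divfK.
  apply: eq_bigl => y; rewrite !inE mulfK // eqxx andbT mulf_eq0 (negPf x0) orbF.
  case: eqP => //= _; apply/idP/idP => [yxK|yK].
    by rewrite -(mulfK x0 y) (subfield_div Kq).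
  exact: (subfieldM Kq).
rewrite big_split /= prodr_const => prodE.
have xn1 : x ^+ #|K :\ 0| = 1 by apply: (mulfI prod_neq0); rewrite mulr1 -prodE.
have := cardsD1 0 K; rewrite cardK (subfield0 Kq) add1n => ->.
by rewrite exprS xn1 mulr1.
Qed.

End SubfieldOfOrder.

(** * Coordinatization *)

Section Triples.
Variable F : fieldType.
Implicit Types (x y z c d : F) (p l : F -> F -> F -> Prop).

Definition nz3 x y z := ~~ [&& x == 0, y == 0 & z == 0].

Lemma nz3P x y z : nz3 x y z -> [\/ x != 0, y != 0 | z != 0].
Proof.
rewrite /nz3 !negb_and; case/or3P; [exact: Or31|exact: Or32|exact: Or33].
Qed.

(** The three equations say that the cross product of [c] and [d] vanishes; the factor is read off
    at a nonzero coordinate of [c]. *)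
Lemma prop3 c1 c2 c3 d1 d2 d3 : nz3 c1 c2 c3 ->
  c2 * d3 = c3 * d2 -> c3 * d1 = c1 * d3 -> c1 * d2 = c2 * d1 ->
  exists k, [/\ d1 = k * c1, d2 = k * c2 & d3 = k * c3].
Proof.
move=> /nz3P[] nz e1 e2 e3.
- exists (d1 / c1); split; apply: (mulfI nz); rewrite ?e3 -?e2; by field.
- exists (d2 / c2); split; apply: (mulfI nz); rewrite -?e3 ?e1; by field.
- exists (d3 / c3); split; apply: (mulfI nz); rewrite -?e1 ?e2; by field.
Qed.

(** By the expansion of the vector triple product, the cross product of [d] with that of [x] and [y]
    is a combination of [x] and [y] whose coefficients are the two vanishing dot products. *)
Lemma orth3 x1 x2 x3 y1 y2 y3 d1 d2 d3 :
  nz3 (x2 * y3 - x3 * y2) (x3 * y1 - x1 * y3) (x1 * y2 - x2 * y1) ->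
  x1 * d1 + x2 * d2 + x3 * d3 = 0 -> y1 * d1 + y2 * d2 + y3 * d3 = 0 ->
  exists k, [/\ d1 = k * (x2 * y3 - x3 * y2), d2 = k * (x3 * y1 - x1 * y3)
              & d3 = k * (x1 * y2 - x2 * y1)].
Proof.
move=> nz xd yd; apply: prop3 => //; apply/eqP; rewrite -subr_eq0.
- have -> : (x3 * y1 - x1 * y3) * d3 - (x1 * y2 - x2 * y1) * d2 =
    y1 * (x1 * d1 + x2 * d2 + x3 * d3) - x1 * (y1 * d1 + y2 * d2 + y3 * d3).
    by ring.
  by rewrite xd yd !mulr0 subr0.
- have -> : (x1 * y2 - x2 * y1) * d1 - (x2 * y3 - x3 * y2) * d3 =
    y2 * (x1 * d1 + x2 * d2 + x3 * d3) - x2 * (y1 * d1 + y2 * d2 + y3 * d3).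
    by ring.
  by rewrite xd yd !mulr0 subr0.
- have -> : (x2 * y3 - x3 * y2) * d2 - (x3 * y1 - x1 * y3) * d1 =
    y3 * (x1 * d1 + x2 * d2 + x3 * d3) - x3 * (y1 * d1 + y2 * d2 + y3 * d3).
    by ring.
  by rewrite xd yd !mulr0 subr0.
Qed.

Lemma orth3_prop x1 x2 x3 y1 y2 y3 d1 d2 d3 z1 z2 z3 :
  nz3 (x2 * y3 - x3 * y2) (x3 * y1 - x1 * y3) (x1 * y2 - x2 * y1) ->
  x1 * d1 + x2 * d2 + x3 * d3 = 0 -> y1 * d1 + y2 * d2 + y3 * d3 = 0 ->
  x1 * z1 + x2 * z2 + x3 * z3 = 0 -> y1 * z1 + y2 * z2 + y3 * z3 = 0 ->
  nz3 d1 d2 d3 -> nz3 z1 z2 z3 ->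
  exists2 k, k != 0 & [/\ z1 = k * d1, z2 = k * d2 & z3 = k * d3].
Proof.
move=> nz xd yd xz yz nzd nzz.
have [k [ed1 ed2 ed3]] := orth3 nz xd yd.
have [k' [ez1 ez2 ez3]] := orth3 nz xz yz.
have k_neq0 : k != 0.
  by apply: contraNneq nzd => k0; rewrite ed1 ed2 ed3 k0 !mul0r eqxx.
have k'_neq0 : k' != 0.
  by apply: contraNneq nzz => k0; rewrite ez1 ez2 ez3 k0 !mul0r eqxx.
exists (k' / k); first by rewrite mulf_neq0 ?invr_eq0.
by rewrite ed1 ed2 ed3 ez1 ez2 ez3 !mulrA !divfK.
Qed.

Lemma cross0_prop x1 x2 x3 y1 y2 y3 : nz3 x1 x2 x3 -> nz3 y1 y2 y3 ->
  ~~ nz3 (x2 * y3 - x3 * y2) (x3 * y1 - x1 * y3) (x1 * y2 - x2 * y1) ->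
  exists2 k, k != 0 & [/\ y1 = k * x1, y2 = k * x2 & y3 = k * x3].
Proof.
move=> nzx nzy /negPn/and3P[/eqP/subr0_eq e1 /eqP/subr0_eq e2 /eqP/subr0_eq e3].
have [k [y1E y2E y3E]] := prop3 nzx e1 e2 e3; exists k => //.
by apply: contraNneq nzy => k0; rewrite y1E y2E y3E k0 !mul0r /nz3 eqxx.
Qed.

(* The triple z, being orthogonal to x and y, is proportional to their cross
   product.  With p the points and l the lines this says that the joins of points
   are lines; with p and l exchanged, that the intersections of lines are points. *)
Definition cross_closed p l := forall x1 x2 x3 y1 y2 y3 z1 z2 z3,
  p x1 x2 x3 -> p y1 y2 y3 ->
  nz3 (x2 * y3 - x3 * y2) (x3 * y1 - x1 * y3) (x1 * y2 - x2 * y1) ->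
  nz3 z1 z2 z3 ->
  x1 * z1 + x2 * z2 + x3 * z3 = 0 -> y1 * z1 + y2 * z2 + y3 * z3 = 0 ->
  l z1 z2 z3.

Definition scale_closed p := forall c x y z,
  c != 0 -> p x y z -> p (c * x) (c * y) (c * z).

Ltac simp3 := rewrite /nz3 ?(mul0r, mulr0, mul1r, mulr1, subr0, sub0r, add0r,
  addr0, mulN1r, mulrN1, mulrN, mulNr, opprK, oppr0, oppr_eq0, oner_eq0, andbF,
  eqxx).
(** [via J u v] obtains the triple in the goal as the join or intersection of [u] and [v]. It
    remains to see that the cross product and the triple are nonzero and that the triple is
    orthogonal to both. *)
Ltac via J u v := apply: (J _ _ _ _ _ _ _ _ _ u v);
  [by simp3|by simp3|ring|ring].
Ltac via_neq0 nz J u v := apply: (J _ _ _ _ _ _ _ _ _ u v);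
  [simp3; by rewrite (negPf nz) ?andbF|simp3; by rewrite ?(negPf nz) ?andbF
  |ring|ring].

(** * Ruler constructions in coordinates with respect to a quadrangle *)

Section Coordinatization.
Variables p l : F -> F -> F -> Prop.
Hypotheses (J : cross_closed p l) (M : cross_closed l p).
Hypothesis sp : scale_closed p.
Hypotheses (p1 : p 1 0 0) (p2 : p 0 1 0) (p3 : p 0 0 1) (pE : p 1 1 1).

(** The sides of the triangle of reference, the joins of its vertices with the unit point, and one
    diagonal point. *)
Let l1 : l 1 0 0. Proof. via J p2 p3. Qed.
Let l2 : l 0 1 0. Proof. via J p1 p3. Qed.
Let l3 : l 0 0 1. Proof. via J p1 p2. Qed.
Let lx : l 0 1 (-1). Proof. via J p1 pE. Qed.
Let ly : l 1 0 (-1). Proof. via J p2 pE. Qed.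
Let lz : l 1 (-1) 0. Proof. via J p3 pE. Qed.
Let pz : p 1 1 0. Proof. via M l3 lz. Qed.

(* Joining with a vertex and intersecting with a line of the quadrangle carries
   the coordinate a from one side of the triangle of reference to another. *)
Lemma coord_1a1 a : p 1 a 0 <-> p 1 a 1.
Proof.
split=> h.
  have h1 : l a (-1) 0 by via J p3 h.
  via M h1 ly.
have h1 : l a (-1) 0 by via J p3 h.
via M h1 l3.
Qed.

Lemma coord_10a a : p 1 a 0 <-> p 1 0 a.
Proof.
split=> h.
  have h1 : l a (-1) 0 by via J p3 h.
  have h2 : p 1 a a by via M h1 lx.
  have h3 : l a 0 (-1) by via J p2 h2.
  via M h3 l2.
have h1 : l a 0 (-1) by via J p2 h.
have h2 : p 1 a a by via M h1 lx.
have h3 : l a (-1) 0 by via J p3 h2.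
via M h3 l3.
Qed.

Lemma coord_0a1 a : p 1 a 0 <-> p 0 a 1.
Proof.
split=> [/coord_1a1 h|h].
  have h1 : l 0 1 (-a) by via J p1 h.
  via M h1 l1.
have h1 : l 0 1 (-a) by via J p1 h.
apply/coord_1a1; via M h1 ly.
Qed.

Lemma coord1 : p 1 1 0. Proof. exact: pz. Qed.

(** The line through (1 : a : 1) and (1 : b : 0) meets the side x = 0 in (0 : a - b : 1). *)
Lemma coordB a b : p 1 a 0 -> p 1 b 0 -> p 1 (a - b) 0.
Proof.
move=> /coord_1a1 ha hb; have h1 : l (- b) 1 (b - a) by via J ha hb.
by apply/coord_0a1; via M h1 l1.
Qed.

(** The lines y = a x and y = b z meet in (b : ab : a), whose projection from (0 : 1 : 0) to the
    side y = 0 is (b : 0 : a). *)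
Lemma coord_div a b : p 1 a 0 -> p 1 b 0 -> p 1 (a / b) 0.
Proof.
(* For [b = 0] the convention [0^-1 = 0] makes the quotient 0, the coordinate of the vertex [p1]. *)
move=> ha hb; have [->|b_neq0] := eqVneq b 0; first by rewrite invr0 mulr0.
have /coord_0a1 h1 := hb.
have h2 : l 0 1 (- b) by via J p1 h1.
have h3 : l a (- 1) 0 by via J p3 ha.
have h4 : p b (a * b) a by via_neq0 b_neq0 M h2 h3.
have h5 : l a 0 (- b) by via_neq0 b_neq0 J p2 h4.
have h6 : p b 0 a by via_neq0 b_neq0 M l2 h5.
have bV_neq0 : b^-1 != 0 by rewrite invr_eq0.
apply/coord_10a; have := sp bV_neq0 h6.
by rewrite mulVf // mulr0 (mulrC _ a).
Qed.

Lemma coord_opp a : p 1 a 0 -> p 1 (- a) 0.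
Proof. by rewrite -(sub0r a); exact/coordB/p1. Qed.

(** For nonzero [a] the right-hand triple is a multiple of (1 : -1/a : 0). It is the form in which a
    line with coefficients 1, a meets the side z = 0. *)
Lemma coord_swap a : p 1 a 0 <-> p (- a) 1 0.
Proof.
have [->|a_neq0] := eqVneq a 0; first by rewrite oppr0; split.
have aV_neq0 : a^-1 != 0 by rewrite invr_eq0.
split=> h.
  have h1 : p 1 (- (1 / a)) 0 by apply/coord_opp/coord_div => //; exact: pz.
  have Na_neq0 : - a != 0 by rewrite oppr_eq0.
  have := sp Na_neq0 h1.
  by rewrite mulr1 mulr0 mulrNN mul1r divff.
have NaV_neq0 : - a^-1 != 0 by rewrite oppr_eq0.
have := sp NaV_neq0 h; rewrite mulrNN mulVf // mulr1 mulr0 => h1.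
have := coord_opp (coord_div pz h1); by rewrite invrN invrK mul1r opprK.
Qed.

(** The coordinates are the projections from the vertices (0 : 0 : 1) and (0 : 1 : 0), and the point
    is recovered by intersecting the two projecting lines. *)
Lemma coord_point x y : p 1 x y <-> p 1 x 0 /\ p 1 y 0.
Proof.
split=> [h|[hx /coord_10a hy]].
  have h1 : l x (-1) 0 by via J p3 h.
  have h2 : l y 0 (-1) by via J p2 h.
  by split; [via M l3 h1|apply/coord_10a; via M l2 h2].
have h1 : l x (-1) 0 by via J p3 hx.
have h2 : l y 0 (-1) by via J p2 hy.
via M h1 h2.
Qed.

(** The line meets the sides z = 0 and y = 0 in (-e : 1 : 0) and (-f : 0 : 1); the second point is
    carried to z = 0 by way of (-f : 1 : 1). *)
Lemma coord_line e f : l 1 e f <-> p 1 e 0 /\ p 1 f 0.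
Proof.
split=> [h|[/coord_swap he /coord_swap hf]].
  have h1 : p (- e) 1 0 by via M l3 h.
  have h2 : p (- f) 0 1 by via M l2 h.
  have h3 : l 1 0 f by via J p2 h2.
  have h4 : p (- f) 1 1 by via M h3 lx.
  split; apply/coord_swap => //.
  have h5 : l 1 f 0 by via J p3 h4.
  via M l3 h5.
have h1 : l 1 f 0 by via J p3 hf.
have h2 : p (- f) 1 1 by via M h1 lx.
have h3 : l 1 0 f by via J p2 h2.
have h4 : p (- f) 0 1 by via M l2 h3.
via J he h4.
Qed.

End Coordinatization.
End Triples.

(** * Homogeneous coordinates *)

Section Coordinates.
Variable F : finFieldType.
Implicit Types (X Y : point F) (t a b v w : 'rV[F]_3) (x y z d e f : F).
Implicit Types m : line F.

Lemma subspace_eq n r (X Y : subspace F n r) : (X == Y)%MS -> X = Y.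
Proof.
move=> /genmxP eXY; apply: val_inj => /=.
by case: X eXY => X /= /andP[/eqP-> _]; case: Y => Y /= /andP[/eqP-> _].
Qed.

Lemma mxrank_subspace n r (X : subspace F n r) : \rank X = r.
Proof. by case: X => X /= /andP[_ /eqP]. Qed.

Lemma subspace_of_mx n r k (A : 'M[F]_(k, n)) :
  \rank A = r -> exists X : subspace F n r, (X == A)%MS.
Proof.
move=> rkA; have gen : (<<<<A>>>>%MS == <<A>>%MS) && (\rank <<A>>%MS == r).
  by rewrite genmx_id eqxx mxrank_gen rkA eqxx.
by exists (Subspace gen); apply/eqmxP/genmxE.
Qed.

Lemma point_vec n (X : subspace F n 1) :
  exists2 v : 'rV[F]_n, v != 0 & (X == v)%MS.
Proof.
have nzX : X != 0 :> 'M_n by rewrite -mxrank_eq0 mxrank_subspace.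
exists (nz_row X); first by rewrite nz_row_eq0.
rewrite andbC; have := mxrank_leqif_eq (nz_row_sub X).
by case=> _ <-; rewrite mxrank_subspace rank_rV nz_row_eq0 nzX.
Qed.

Lemma vec_point n (v : 'rV[F]_n) :
  v != 0 -> exists X : subspace F n 1, (X == v)%MS.
Proof. by move=> nzv; apply: subspace_of_mx; rewrite rank_rV nzv. Qed.

Lemma eq_point n (X Y : subspace F n 1) (v : 'rV[F]_n) :
  (X == v)%MS -> (Y == v)%MS -> X = Y.
Proof.
move=> /eqmxP Xv /eqmxP Yv; apply: subspace_eq; apply/eqmxP.
exact: eqmx_trans Xv (eqmx_sym Yv).
Qed.

Lemma eqmx_vec n (X : subspace F n 1) (v w : 'rV[F]_n) :
  (X == v)%MS -> (X == w)%MS -> exists2 k, k != 0 & v = k *: w.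
Proof.
move=> Xv Xw.
have nzv : v != 0 by rewrite -mxrank_eq0 -(eqmx_rank Xv) mxrank_subspace.
have /sub_rVP[k vE] : (v <= w)%MS by rewrite -(eqmxP Xv) (eqmxP Xw).
by exists k => //; apply: contraNneq nzv => k0; rewrite vE k0 scale0r.
Qed.

Lemma eqmx_scale_vec n (X : subspace F n 1) (v : 'rV[F]_n) k :
  k != 0 -> (X == k *: v)%MS = (X == v)%MS.
Proof. by move=> nzk; rewrite !(eqmx_scale v nzk). Qed.

Lemma incident_vec X v m : (X == v)%MS -> incident X m = (v <= m)%MS.
Proof. by move=> /eqmxP Xv; rewrite /incident Xv. Qed.

Definition comb3 t a b x y z := x *: t + y *: a + z *: b.

Definition free3 t a b := forall x y z,
  comb3 t a b x y z = 0 -> [/\ x = 0, y = 0 & z = 0].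

Let row3 x y z : 'rV[F]_3 := \row_i [:: x; y; z]`_i.
Let mx3 t a b : 'M[F]_3 := \matrix_i [:: t; a; b]`_i.

Let row3E (v : 'rV_3) : exists x y z, v = row3 x y z.
Proof.
exists (v 0 0), (v 0 1), (v 0 (inord 2)); apply/rowP => i; rewrite !mxE.
by case: i => [[|[|[|//]]] lti] /=; congr (v 0 _); apply: val_inj;
  rewrite /= ?inordK.
Qed.

Let row3_mul t a b x y z : row3 x y z *m mx3 t a b = comb3 t a b x y z.
Proof.
rewrite mulmx_sum_row !big_ord_recl big_ord0 /comb3 addr0 addrA !rowK !mxE /=.
by [].
Qed.

Let row3_dot x y z d e f :
  (row3 x y z *m (row3 d e f)^T == 0) = (d * x + e * y + f * z == 0).
Proof.
have -> : d * x + e * y + f * z = (row3 x y z *m (row3 d e f)^T) 0 0.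
  by rewrite !mxE !big_ord_recl big_ord0 !mxE /=; ring.
apply/eqP/eqP => [->|h]; first by rewrite mxE.
by apply/matrixP => i j; rewrite !ord1 h mxE.
Qed.

Let row3_eq0 x y z : (row3 x y z != 0) = nz3 x y z.
Proof.
congr (~~ _); apply/eqP/and3P => [/rowP h|[/eqP-> /eqP-> /eqP->]].
  have h0 := h 0; have h1 := h 1; have h2 := h (inord 2).
  by move: h0 h1 h2; rewrite !mxE /= inordK //= => -> -> ->.
by apply/rowP => i; rewrite !mxE; case: i => [[|[|[|]]]].
Qed.

Let unit_mx3 t a b : free3 t a b -> mx3 t a b \in unitmx.
Proof.
move=> tab; rewrite -row_free_unit; apply: inj_row_free => v.
have [x [y [z ->]]] := row3E v; rewrite row3_mul => /tab[-> -> ->].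
by apply/eqP; apply: contraT; rewrite row3_eq0 /nz3 eqxx.
Qed.

Lemma span3 t a b : free3 t a b -> forall v, exists x y z, v = comb3 t a b x y z.
Proof.
move=> /unit_mx3 uM v; have [x [y [z e]]] := row3E (v *m invmx (mx3 t a b)).
by exists x, y, z; rewrite -row3_mul -e mulmxKV.
Qed.

Definition line_eq t a b m d e f := forall x y z,
  (comb3 t a b x y z <= m)%MS = (d * x + e * y + f * z == 0).

Lemma line_eq_inj t a b m m' d e f : free3 t a b ->
  line_eq t a b m d e f -> line_eq t a b m' d e f -> m = m'.
Proof.
move=> /span3 tab eqm eqm'; apply: subspace_eq.
by apply/andP; split; apply/rV_subP => v; have [x [y [z ->]]] := tab v;
  rewrite eqm eqm'.
Qed.

Lemma line_eq_scale t a b m k d e f : k != 0 ->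
  line_eq t a b m d e f -> line_eq t a b m (k * d) (k * e) (k * f).
Proof.
move=> nzk eqm x y z; rewrite eqm -!mulrA -!mulrDr mulf_eq0 (negPf nzk) /=.
by [].
Qed.

Lemma line_exists t a b d e f : free3 t a b -> nz3 d e f ->
  exists m, line_eq t a b m d e f.
Proof.
move=> /unit_mx3 uM nz; pose A := invmx (mx3 t a b) *m (row3 d e f)^T.
have rkA : \rank (kermx A) = 2%N.
  rewrite mxrank_ker eqmxMfull ?row_full_unit ?unitmx_inv // mxrank_tr rank_rV.
  by rewrite row3_eq0 nz.
have [m mA] := subspace_of_mx rkA; exists m => x y z.
by rewrite (eqmxP mA) sub_kermx -row3_mul mulmxA mulmxK // row3_dot.
Qed.

(** The cokernel of [m] has rank 1, so its transpose is spanned by a single row, which serves as a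
    normal vector. *)
Lemma line_normal m : exists2 w : 'rV[F]_3, w != 0 &
  forall v, (v <= m)%MS = (v *m w^T == 0).
Proof.
have rk1 : \rank (cokermx m)^T = 1%N.
  by rewrite mxrank_tr mxrank_coker mxrank_subspace.
have [X mX] := subspace_of_mx rk1.
have [w nzw Xw] := point_vec X; exists w => // v.
have [D wE] : exists D, w = D *m (cokermx m)^T.
  by apply/submxP; rewrite -(eqmxP mX) (eqmxP Xw).
have [E cE] : exists E, (cokermx m)^T = E *m w.
  by apply/submxP; rewrite -(eqmxP Xw) (eqmxP mX).
rewrite submxE; apply/eqP/eqP => h.
  by rewrite wE trmx_mul trmxK mulmxA h mul0mx.
by rewrite -[cokermx m]trmxK cE trmx_mul mulmxA h mul0mx.
Qed.

Lemma line_coord t a b m : free3 t a b ->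
  exists d e f, nz3 d e f /\ line_eq t a b m d e f.
Proof.
move=> /unit_mx3 uM; have [w nzw mw] := line_normal m.
have [d [e [f E]]] := row3E (w *m (mx3 t a b)^T); exists d, e, f; split.
  rewrite -row3_eq0 -E; apply: contraNneq nzw => e0.
  by rewrite -[w](@mulmxK _ _ _ (mx3 t a b)^T) ?unitmx_tr // e0 mul0mx.
by move=> x y z; rewrite mw -row3_dot -E trmx_mul trmxK mulmxA row3_mul.
Qed.

Lemma comb3_scale t a b k x y z :
  comb3 t a b (k * x) (k * y) (k * z) = k *: comb3 t a b x y z.
Proof. by rewrite /comb3 !scalerDr !scalerA. Qed.

Lemma comb3_inj t a b x y z x' y' z' : free3 t a b ->
  comb3 t a b x y z = comb3 t a b x' y' z' -> [/\ x = x', y = y' & z = z'].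
Proof.
move=> tab e; have /tab[] : comb3 t a b (x - x') (y - y') (z - z') = 0.
  move/eqP: e; rewrite -subr_eq0 => /eqP<-; rewrite /comb3 !scalerBl.
  by rewrite (addrACA (x *: t)) (addrACA (x *: t + y *: a)) -!opprD.
by move=> /subr0_eq-> /subr0_eq-> /subr0_eq->.
Qed.

Lemma comb3_neq0 t a b x y z : free3 t a b ->
  (comb3 t a b x y z != 0) = nz3 x y z.
Proof.
move=> tab; congr (~~ _); apply/eqP/and3P => [/tab[-> -> ->] //|].
by case=> /eqP-> /eqP-> /eqP->; rewrite /comb3 !scale0r !addr0.
Qed.

Lemma point_neq t a b X Y x1 x2 x3 y1 y2 y3 : free3 t a b ->
  (X == comb3 t a b x1 x2 x3)%MS -> (Y == comb3 t a b y1 y2 y3)%MS ->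
  nz3 (x2 * y3 - x3 * y2) (x3 * y1 - x1 * y3) (x1 * y2 - x2 * y1) -> X != Y.
Proof.
move=> tab Xx Yy; apply: contraNneq => eXY; rewrite -eXY in Yy.
have [k nzk] := eqmx_vec Xx Yy; rewrite -comb3_scale.
by move=> /(comb3_inj tab)[-> -> ->]; apply/and3P; split; apply/eqP; ring.
Qed.

End Coordinates.

(* Inside (_ == _)%MS the arguments would otherwise be parsed in the scope of
   subspaces, where + and * are not the field operations. *)
Arguments comb3 {F} (t a b x y z)%_R.

(** * Quadrangles of a subplane *)

Section Subplane.
Variables (F : finFieldType) (q : nat).
Implicit Types (t a b v w : 'rV[F]_3) (x y z c d e f : F) (m : line F).
Implicit Types (X : point F) (K : {set F}).

(** Independence of [u] and [v] makes the listed points distinct. The count is used both for a side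
    of a quadrangle in a given subplane and for the lines of the model. *)
Lemma card_affine_line n (u v : 'rV[F]_n) K (S : {set subspace F n 1}) :
  (forall x y, x *: v + y *: u = 0 -> x = 0 /\ y = 0) ->
  (forall X : subspace F n 1, X \in S <->
     (X == u)%MS \/ exists2 c, c \in K & (X == (v + c *: u)%R)%MS) ->
  #|S| = #|K|.+1.
Proof.
move=> indep memS.
have nzu : u != 0.
  apply/eqP => u0; have [] := indep 0 1; first by rewrite u0 scaler0 scale0r addr0.
  by move=> _ /eqP; rewrite oner_eq0.
have nzv c : v + c *: u != 0.
  apply/eqP => h; have [] := indep 1 c; first by rewrite scale1r.
  by move=> /eqP; rewrite oner_eq0.
have [U Uu] := vec_point nzu.
(* The point spanned by [w]; the default [U] is taken only for [w = 0]. *)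
pose pt (w : 'rV[F]_n) := odflt U [pick X : subspace F n 1 | (X == w)%MS].
have ptE (w : 'rV[F]_n) : w != 0 -> (pt w == w)%MS.
  by rewrite /pt; case: pickP => //= h /vec_point[X]; rewrite h.
have -> : S = U |: [set pt (v + c *: u) | c in K].
  apply/setP => X; rewrite in_setU1; apply/idP/idP.
    case/memS => [Xu|[c cK Xc]]; first by rewrite (eq_point Xu Uu) eqxx.
    apply/orP; right; apply/imsetP; exists c => //.
    exact: eq_point Xc (ptE _ (nzv c)).
  case/predU1P => [->|/imsetP[c cK ->]]; apply/memS; first by left.
  by right; exists c => //; exact: ptE.
rewrite cardsU1 card_in_imset => [|c c' _ _ ecc'].
  case: imsetP => // -[c _ Uc]; have /eqmxP h := ptE _ (nzv c).
  rewrite -Uc in h; have [k nzk uE] : exists2 k, k != 0 & u = k *: (v + c *: u).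
    by apply: eqmx_vec Uu _; apply/eqmxP.
  have [] := indep k (k * c - 1).
    by rewrite scalerBl -scalerA addrA -scalerDr -uE scale1r subrr.
  by move=> k0; rewrite k0 eqxx in nzk.
have ptc := ptE _ (nzv c'); rewrite -ecc' in ptc.
have [k _ e] := eqmx_vec (ptE _ (nzv c)) ptc; have [] := indep (1 - k) (c - k * c').
  rewrite !scalerBl scale1r -(scalerA k) addrACA e scalerDr.
  by rewrite -opprD subrr.
by move=> /subr0_eq <- /subr0_eq; rewrite mul1r.
Qed.

Section Frame.
Variables (P : {set point F}) (L : {set line F}).
Hypothesis PL : subplane q P L.

Definition has_point t a b x y z :=
  exists2 X, X \in P & (X == comb3 t a b x y z)%MS.

Definition has_line t a b d e f := exists2 m, m \in L & line_eq t a b m d e f.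

Lemma has_point_scale t a b : scale_closed (has_point t a b).
Proof.
move=> c x y z nzc [X XP Xx]; exists X => //.
by rewrite comb3_scale eqmx_scale_vec.
Qed.

Lemma has_line_scale t a b : scale_closed (has_line t a b).
Proof.
by move=> c d e f nzc [m mL md]; exists m => //; apply: line_eq_scale.
Qed.

(** The coordinates of the line of the subplane joining the two points are orthogonal to both
    triples, hence proportional to [z]. *)
Lemma join_closed t a b :
  free3 t a b -> cross_closed (has_point t a b) (has_line t a b).
Proof.
move=> tab x1 x2 x3 y1 y2 y3 z1 z2 z3 [X XP Xx] [Y YP Yy] nzc nzz xz yz.
have neqXY := point_neq tab Xx Yy nzc.
have [m [[mL Xm Ym] _]] := pp_join PL XP YP neqXY.
have [d [e [f [nzd md]]]] := line_coord m tab.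
move: Xm Ym; rewrite (incident_vec _ Xx) (incident_vec _ Yy) !md.
move=> /eqP xd /eqP yd.
have [||k nzk [-> -> ->]] := orth3_prop nzc _ _ xz yz nzd nzz.
- by rewrite -xd; ring.
- by rewrite -yd; ring.
by exists m => //; apply: line_eq_scale.
Qed.

Lemma meet_closed t a b :
  free3 t a b -> cross_closed (has_line t a b) (has_point t a b).
Proof.
move=> tab x1 x2 x3 y1 y2 y3 z1 z2 z3 [m mL mx] [m' m'L my] nzc nzz xz yz.
have neqm : m != m'.
  (* If the lines coincided, every triple orthogonal to [x] would be orthogonal to [y]; the three
     test triples below then give the entries of the cross product. *)
  apply: contraNneq nzc => em; rewrite -em in my.
  have xy (u v w : F) :
      x1 * u + x2 * v + x3 * w = 0 -> y1 * u + y2 * v + y3 * w = 0.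
    by move=> h; apply/eqP; rewrite -my mx h.
  apply/and3P; split; apply/eqP.
  - by rewrite -[RHS]oppr0 -(xy 0 x3 (- x2)); ring.
  - by rewrite -[RHS]oppr0 -(xy (- x3) 0 x1); ring.
  - by rewrite -[RHS]oppr0 -(xy x2 (- x1) 0); ring.
have [X [[XP Xm Xm'] _]] := pp_meet PL mL m'L neqm.
have [v nzv Xv] := point_vec X; have [d [e [f vE]]] := span3 tab v.
rewrite {}vE in nzv Xv; rewrite comb3_neq0 // in nzv.
move: Xm Xm'; rewrite !(incident_vec _ Xv) mx my => /eqP xd /eqP yd.
have [k nzk [-> -> ->]] := orth3_prop nzc xd yd xz yz nzv nzz.
by apply: has_point_scale => //; exists X.
Qed.

(** The vectors [t], [a], [b] and their sum span the four points of a quadrangle, so these are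
    projective coordinates with that sum as unit point. *)
Definition frame t a b := [/\ free3 t a b, has_point t a b 1 0 0,
  has_point t a b 0 1 0, has_point t a b 0 0 1 & has_point t a b 1 1 1].

Lemma comb3_rot t a b x y z : comb3 a b t x y z = comb3 t a b z x y.
Proof. by rewrite /comb3 addrC addrA. Qed.

(** This allows any chosen nonzero coordinate of a point to be put first. *)
Lemma frame_rot t a b : frame t a b -> frame a b t.
Proof.
have rot x y z : has_point t a b z x y -> has_point a b t x y z.
  by case=> X XP Xx; exists X; rewrite // comb3_rot.
case=> tab p1 p2 p3 pE; split; try exact: rot.
by move=> x y z; rewrite comb3_rot => /tab[].
Qed.

(** Three points of the quadrangle give a basis, and every coordinate of the fourth is nonzero
    because no three are collinear. Rescaling the basis by these coordinates turns the fourth into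
    the unit point. *)
Lemma frame_exists : exists t a b, frame t a b.
Proof.
have [Q [sQP cardQ ncol]] := pp_quadrangle PL.
(* A dependency with nonzero last coefficient would put the third point on the join of the first
   two, and a line of the subplane would carry three points of [Q]. *)
have indep X Y Z u v w x y z : X \in Q -> Y \in Q -> Z \in Q ->
    X != Y -> X != Z -> Y != Z -> (X == u)%MS -> (Y == v)%MS -> (Z == w)%MS ->
    comb3 u v w x y z = 0 -> z = 0.
  move=> XQ YQ ZQ nXY nXZ nYZ Xu Yv Zw e; apply/eqP/negP => /negP nzz.
  have [m [[mL Xm Ym] _]] := pp_join PL (subsetP sQP X XQ) (subsetP sQP Y YQ) nXY.
  have Zm : incident Z m.
    rewrite (incident_vec _ Zw).
    have -> : w = - (z^-1 * x) *: u - (z^-1 * y) *: v.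
      apply: (scalerI nzz); rewrite scalerBr scaleNr scalerN !scalerA !mulVKf //.
      by rewrite -opprD; apply/eqP; rewrite -addr_eq0 addrC -/(comb3 _ _ _ _ _ _) e.
    rewrite -scaleNr addmx_sub // scalemx_sub //.
      by rewrite -(incident_vec _ Xu).
    by rewrite -(incident_vec _ Yv).
  have := ncol m mL; apply/negP; rewrite -ltnNge.
  have card3 : (2 < #|[set X; Y; Z]|)%N.
    by rewrite setUC cardsU1 cards2 !inE !(eq_sym Z) (negPf nXZ) (negPf nYZ) nXY.
  apply/(leq_trans card3)/subset_leq_card/subsetP => A; rewrite !inE.
  by case/orP => [/orP[]|] /eqP->; rewrite ?XQ ?YQ ?ZQ.
have := enum_uniq Q; have memQ X : X \in enum Q -> X \in Q by rewrite mem_enum.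
move: cardQ memQ; rewrite cardE.
case: (enum Q) => [|X1 [|X2 [|X3 [|X4 [|]]]]] //= _ memQ.
rewrite !inE !negb_or -!andbA => /and5P[n12 n13 n14 n23 /and3P[n24 n34 _]].
have [Q1 Q2 Q3 Q4] : [/\ X1 \in Q, X2 \in Q, X3 \in Q & X4 \in Q].
  by split; apply: memQ; rewrite !inE eqxx ?orbT.
have [v1 _ Xv1] := point_vec X1; have [v2 _ Xv2] := point_vec X2.
have [v3 _ Xv3] := point_vec X3; have [v4 _ Xv4] := point_vec X4.
have free123 : free3 v1 v2 v3.
  move=> x y z e; split.
  - apply: (indep X2 X3 X1 v2 v3 v1 y z x); rewrite // 1?eq_sym //.
    by rewrite comb3_rot.
  - apply: (indep X3 X1 X2 v3 v1 v2 z x y); rewrite // 1?eq_sym //.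
    by rewrite -comb3_rot.
  - exact: (indep X1 X2 X3 v1 v2 v3 x y z).
have [x [y [z v4E]]] := span3 free123 v4.
have N1_neq0 : (-1 : F) <> 0 by apply/eqP; rewrite oppr_eq0 oner_eq0.
have nzx : x != 0.
  apply/eqP => x0; apply/N1_neq0/(indep X2 X3 X4 v2 v3 v4 y z (-1)) => //.
  by rewrite v4E x0 /comb3 scale0r add0r scaleN1r subrr.
have nzy : y != 0.
  apply/eqP => y0; apply/N1_neq0/(indep X1 X3 X4 v1 v3 v4 x z (-1)) => //.
  by rewrite v4E y0 /comb3 scale0r addr0 scaleN1r subrr.
have nzz : z != 0.
  apply/eqP => z0; apply/N1_neq0/(indep X1 X2 X4 v1 v2 v4 x y (-1)) => //.
  by rewrite v4E z0 /comb3 scale0r addr0 scaleN1r subrr.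
exists (x *: v1), (y *: v2), (z *: v3); split.
- move=> x' y' z'; rewrite /comb3 !scalerA => /free123[].
  by move=> /eqP + /eqP + /eqP; rewrite !mulf_eq0 (negPf nzx) (negPf nzy)
    (negPf nzz) !orbF => /eqP-> /eqP-> /eqP->.
- exists X1; first exact: (subsetP sQP).
  by rewrite /comb3 !scale0r !addr0 scale1r eqmx_scale_vec.
- exists X2; first exact: (subsetP sQP).
  by rewrite /comb3 !scale0r addr0 add0r scale1r eqmx_scale_vec.
- exists X3; first exact: (subsetP sQP).
  by rewrite /comb3 !scale0r !add0r scale1r eqmx_scale_vec.
- exists X4; first exact: (subsetP sQP).
  by rewrite /comb3 !scale1r -/(comb3 _ _ _ _ _ _) -v4E.
Qed.

Hypothesis q_pp : exists p k : nat, [/\ prime p, (0 < k)%N & q = (p ^ k)%N].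
Hypothesis cardF : #|F| = (q ^ 3)%N.
Let K := frob_fixed F q.

(** The ruler constructions make the admissible [c] a subfield. The line z = 0 has [q + 1] points in
    the subplane, all but that of [a] of the form (1 : c : 0), so the subfield has order [q] and is
    [K] by uniqueness. *)
Lemma has_point_fixed t a b c : frame t a b -> has_point t a b 1 c 0 <-> c \in K.
Proof.
move=> [tab p1 p2 p3 pE].
have J := join_closed tab; have M := meet_closed tab.
have sp := @has_point_scale t a b.
pose K0 := [set c | [exists X in P, (X == comb3 t a b 1 c 0)%MS]].
have K0P c' : reflect (has_point t a b 1 c' 0) (c' \in K0).
  by rewrite inE; apply: exists_inP.
suff <- : K0 = K by split=> /K0P.
apply: subfield_frob_fixed => //; split.
  split=> [|x y /K0P xK /K0P yK|x y /K0P xK /K0P yK]; apply/K0P.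
  - exact: (coord1 J M).
  - exact: (coordB J M).
  - exact: (coord_div J M).
have [m mL me] : has_line t a b 0 0 1.
  apply: (J _ _ _ _ _ _ _ _ _ p1 p2); try by ring.
    by rewrite /nz3 !(mul0r, mulr0, mul1r, subr0) oner_eq0 !andbF.
  by rewrite /nz3 oner_eq0 !andbF.
apply/eqP; rewrite -eqSS -(pp_order PL mL); apply/eqP/esym.
apply: (@card_affine_line _ a t) => [x y e|X].
  by have [] := tab x y 0; rewrite // /comb3 scale0r addr0.
have combE c' : comb3 t a b 1 c' 0 = (t + c' *: a)%R.
  by rewrite /comb3 scale1r scale0r addr0.
rewrite inE; split=> [/andP[XP Xm]|].
  have [v nzv Xv] := point_vec X; have [x [y [z vE]]] := span3 tab v.
  rewrite {}vE in nzv Xv; move: Xm; rewrite (incident_vec _ Xv) me.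
  rewrite !mul0r !add0r mul1r => /eqP z0; rewrite z0 in nzv Xv.
  have [x0|nzx] := eqVneq x 0.
    left; rewrite x0 /comb3 !scale0r add0r addr0 eqmx_scale_vec // in Xv.
    by apply: contraNneq nzv => y0; rewrite x0 y0 /comb3 !scale0r !addr0.
  right; exists (x^-1 * y).
    apply/K0P; exists X => //; have nzV : x^-1 != 0 by rewrite invr_eq0.
    rewrite -(mulVf nzx) -[X in comb3 _ _ _ _ _ X](mulr0 x^-1).
    by rewrite comb3_scale eqmx_scale_vec.
  rewrite -combE -[X in comb3 _ _ _ X _ _](mulVf nzx).
  rewrite -[X in comb3 _ _ _ _ _ X](mulr0 x^-1).
  by rewrite comb3_scale eqmx_scale_vec ?invr_eq0.
have a_comb : comb3 t a b 0 1 0 = a by rewrite /comb3 !scale0r add0r addr0 scale1r.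
case=> [Xa|[c' /K0P[Y YP Yc] Xc]].
  have [Y YP Yp] := p2; rewrite a_comb in Yp; rewrite (eq_point Xa Yp) YP /=.
  by rewrite (incident_vec _ Yp) -a_comb me !mul0r !mulr0 !addr0 eqxx.
rewrite -combE in Xc; rewrite (eq_point Xc Yc) YP (incident_vec _ Yc) me.
by rewrite !mul0r !mulr0 !addr0 eqxx.
Qed.

Lemma frame_point t a b x y :
  frame t a b -> has_point t a b 1 x y <-> x \in K /\ y \in K.
Proof.
move=> fr; have [tab p1 p2 p3 pE] := fr.
have J := join_closed tab; have M := meet_closed tab.
by rewrite (coord_point J M) // !has_point_fixed.
Qed.

Lemma frame_line t a b e f :
  frame t a b -> has_line t a b 1 e f <-> e \in K /\ f \in K.
Proof.
move=> fr; have [tab p1 p2 p3 pE] := fr.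
have J := join_closed tab; have M := meet_closed tab.
by rewrite (coord_line J M (@has_point_scale t a b)) // !has_point_fixed.
Qed.

Lemma frame_axis t a b : frame t a b ->
  [/\ has_line t a b 1 0 0, has_line t a b 0 1 0 & has_line t a b 0 0 1].
Proof.
case=> tab p1 p2 p3 pE; have J := join_closed tab.
split; [apply: (J _ _ _ _ _ _ _ _ _ p2 p3)|apply: (J _ _ _ _ _ _ _ _ _ p1 p3)
  |apply: (J _ _ _ _ _ _ _ _ _ p1 p2)]; try ring;
by rewrite /nz3 ?(mul0r, mulr0, mul1r, subr0, sub0r, oppr_eq0) oner_eq0 ?andbF.
Qed.

(** Only [t] is replaced, by the representative of [T] with first coordinate 1. The new unit point
    is (1 : y' + 1 : z' + 1) in the old frame, which has coordinates in [K] and so lies in [P]. *)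
Lemma frame_at_coord t a b T x y z : frame t a b -> T \in P ->
  (T == comb3 t a b x y z)%MS -> x != 0 ->
  exists t' a' b', frame t' a' b' /\ (T == t')%MS.
Proof.
move=> fr TP Tx nzx; have [tab p1 p2 p3 pE] := fr.
have Kq := subfield_order_frob_fixed q_pp cardF.
have nzV : x^-1 != 0 by rewrite invr_eq0.
have Tt' : (T == comb3 t a b 1 (x^-1 * y) (x^-1 * z))%MS.
  by rewrite -(mulVf nzx) comb3_scale eqmx_scale_vec.
have [yK zK] : x^-1 * y \in K /\ x^-1 * z \in K.
  by apply/(frame_point _ _ fr); exists T.
set y' := x^-1 * y in Tt' yK *; set z' := x^-1 * z in Tt' zK *.
set t' := comb3 _ _ _ _ _ _ in Tt'.
have combE c d e : comb3 t' a b c d e = comb3 t a b c (c * y' + d) (c * z' + e).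
  rewrite /t' /comb3 scale1r !scalerDr !scalerA !scalerDl -!addrA.
  by congr (_ + (_ + _)); rewrite addrCA.
have KD c : c \in K -> c + 1 \in K.
  by move=> cK; rewrite (subfieldD Kq) ?(subfield1 Kq).
exists t', a, b; split=> //; split.
- by move=> c d e; rewrite combE => /tab[->]; rewrite !mul0r !add0r.
- by exists T; rewrite // combE !mul1r !addr0.
- by have [X XP Xp] := p2; exists X; rewrite // combE !mul0r !add0r.
- by have [X XP Xp] := p3; exists X; rewrite // combE !mul0r !add0r.
have [X XP Xp] : has_point t a b 1 (y' + 1) (z' + 1).
  by apply/(frame_point _ _ fr); rewrite !KD.
by exists X; rewrite // combE !mul1r.
Qed.

Lemma frame_at T : T \in P -> exists t a b, frame t a b /\ (T == t)%MS.
Proof.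
move=> TP; have [t [a [b fr]]] := frame_exists; have [tab _ _ _ _] := fr.
have [v nzv Tv] := point_vec T; have [x [y [z vE]]] := span3 tab v.
rewrite {}vE comb3_neq0 // in nzv Tv; case/nz3P: nzv => nz.
- exact: frame_at_coord fr TP Tv nz.
- apply: frame_at_coord (frame_rot fr) TP _ nz.
  by rewrite comb3_rot; exact: Tv.
- apply: frame_at_coord (frame_rot (frame_rot fr)) TP _ nz.
  by rewrite comb3_rot comb3_rot; exact: Tv.
Qed.

End Frame.
End Subplane.

(** * The splash of a tangent subplane *)

Section Splash.
Variables (F : finFieldType) (q : nat).
Implicit Types (t a b v w : 'rV[F]_3) (x y z c d e f : F) (m l : line F).
Implicit Types (X T : point F) (P S : {set point F}) (L : {set line F}).

Hypothesis q_pp : exists p k : nat, [/\ prime p, (0 < k)%N & q = (p ^ k)%N].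
Hypothesis cardF : #|F| = (q ^ 3)%N.
Let K := frob_fixed F q.

(** The line [l] passes through [t] but not through the point of [a], so its equation is y = th z. A
    line x + g2 y + g3 z = 0 with coefficients in [K] meets it where z = 1 and x = - g3 - g2 th. *)
Lemma splash_frame l T P L t a b :
  subplane q P L -> [set X in P | incident X l] = [set T] ->
  frame P t a b -> (T == t)%MS ->
  exists th, forall X,
    incident X l && [exists m in L, incident X m] <->
    (X == t)%MS \/ exists k1 k2,
      [/\ k1 \in K, k2 \in K & (X == comb3 t a b (k1 + k2 * th) th 1)%MS].
Proof.
move=> PL Pl fr Tt; have [tab p1 p2 p3 pE] := fr.
have KN := subfieldN (subfield_order_frob_fixed q_pp cardF).
have frl e f := frame_line PL q_pp cardF e f fr.
have Tl : incident T l by have := set11 T; rewrite -Pl inE => /andP[].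
have t_comb : comb3 t a b 1 0 0 = t by rewrite /comb3 !scale0r !addr0 scale1r.
have Pl_T x y z : has_point P t a b x y z -> (comb3 t a b x y z <= l)%MS ->
    y = 0 /\ z = 0.
  case=> X XP Xx; rewrite -(incident_vec _ Xx) => Xl.
  have : X \in [set T] by rewrite -Pl inE XP.
  rewrite inE => /eqP XT; rewrite XT in Xx.
  have [k _] := eqmx_vec Xx Tt; rewrite -[X in _ *: X]t_comb.
  by rewrite -comb3_scale !mulr0 => /(comb3_inj tab)[].
have [d [e [f [nzl le]]]] := line_coord l tab.
have d0 : d = 0.
  by move: Tl; rewrite (incident_vec _ Tt) -t_comb le mulr1 !mulr0 !addr0 => /eqP.
rewrite d0 in le; have nze : e != 0.
  apply/eqP => e0; have [] := Pl_T _ _ _ p2; last by move/eqP; rewrite oner_eq0.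
  by rewrite le e0 !(mul0r, mulr0, addr0).
pose th := - f / e; exists th.
have lth x y z : (comb3 t a b x y z <= l)%MS = (y == th * z).
  rewrite le mul0r add0r addr_eq0 -[RHS](inj_eq (mulfI nze)).
  by have -> : e * (th * z) = - (f * z) by rewrite /th; field.
move=> X; split=> [/andP[Xl /exists_inP[m mL Xm]]|].
  have [v nzv Xv] := point_vec X; have [x [y [z vE]]] := span3 tab v.
  rewrite {}vE comb3_neq0 // in nzv Xv.
  move: Xl; rewrite (incident_vec _ Xv) lth => /eqP yE.
  have [z0|nzz] := eqVneq z 0.
    left; rewrite yE z0 mulr0 in nzv Xv.
    have -> : (X == t)%MS = (X == x *: t)%MS.
      by rewrite eqmx_scale_vec //; apply: contraNneq nzv => ->; rewrite /nz3 eqxx.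
    by move: Xv; rewrite /comb3 !scale0r !addr0.
  right.
  have nzV : z^-1 != 0 by rewrite invr_eq0.
  have {}Xv : (X == comb3 t a b (z^-1 * x) th 1)%MS.
    have -> : comb3 t a b (z^-1 * x) th 1 = z^-1 *: comb3 t a b x y z.
      by rewrite -comb3_scale yE mulVf // (mulrC th) mulKf.
    by rewrite eqmx_scale_vec.
  move: (z^-1 * x) Xv => {nzv}x' Xv.
  have [g1 [g2 [g3 [nzg mg]]]] := line_coord m tab.
  move: Xm; rewrite (incident_vec _ Xv) mg mulr1.
  have [g10|nzg1] := eqVneq g1 0.
    rewrite g10 mul0r add0r => /eqP g3E.
    (* Here m = l would be a line of the subplane, so that its intersection with
       the side x = 0 would be a point of the subplane on l other than T. *)
    have nzg2 : g2 != 0.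
      apply: contraNneq nzg => g20; move: g3E; rewrite g20 mul0r add0r => ->.
      by rewrite g10 /nz3 eqxx.
    have hm : has_line L t a b 0 g2 g3 by exists m; rewrite // -g10.
    have [l1 _ _] := frame_axis PL fr.
    have hp : has_point P t a b 0 th 1.
      apply: (meet_closed PL tab hm l1).
      - rewrite /nz3 !(mul0r, mulr0, mulr1, subr0, sub0r, oppr_eq0).
        by rewrite (negPf nzg2) !andbF.
      - by rewrite /nz3 oner_eq0 !andbF.
      - by rewrite mul0r add0r mulr1.
      - by ring.
    have [] := Pl_T _ _ _ hp; first by rewrite lth mulr1.
    by move=> _ /eqP; rewrite oner_eq0.
  have nzgV : g1^-1 != 0 by rewrite invr_eq0.
  have [g2K g3K] : g1^-1 * g2 \in K /\ g1^-1 * g3 \in K.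
    apply/frl; rewrite -(mulVf nzg1); apply: has_line_scale => //.
    by exists m.
  move=> /eqP xE; exists (- (g1^-1 * g3)), (- (g1^-1 * g2)); split; rewrite ?KN //.
  suff <- : x' = - (g1^-1 * g3) + - (g1^-1 * g2) * th by [].
  by apply: (mulfI nzg1); apply/eqP; rewrite -subr_eq0 -xE; apply/eqP; field.
have [l1 l2 l3] := frame_axis PL fr.
case=> [Xt|[k1 [k2 [k1K k2K Xk]]]].
  (* The centre is covered by the side y = 0 of the frame. *)
  rewrite (eq_point Xt Tt) Tl; apply/exists_inP; have [m mL mE] := l2.
  by exists m; rewrite // (incident_vec _ Tt) -t_comb mE !mulr0 mul0r !addr0 eqxx.
rewrite (incident_vec _ Xk) lth mulr1 eqxx; apply/exists_inP.
have [m mL mE] : has_line L t a b 1 (- k2) (- k1) by apply/frl; rewrite !KN.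
exists m; rewrite // (incident_vec _ Xk) mE; apply/eqP; ring.
Qed.

(** The frame provides an affine coordinate on [l] with origin [th *: a + b] and unit [t]. Passing
    to the origin [u0] and the unit [t0] is the substitution of [be + ga * k] for [k]. *)
Lemma splash_affine l T S t0 u0 :
  tangent_splash q l T S -> (T == t0)%MS ->
  (u0 <= l)%MS -> ~~ (u0 <= t0)%MS ->
  exists be ga th, forall X, X \in S <->
    (X == t0)%MS \/ exists k1 k2, [/\ k1 \in K, k2 \in K &
      (X == (u0 + (be + ga * (k1 + k2 * th)) *: t0)%R)%MS].
Proof.
move=> [P [L [PL Pl ->]]] Tt0 u0l nu0.
have TP : T \in P by have := set11 T; rewrite -Pl inE => /andP[].
have [t [a [b [fr Tt]]]] := frame_at PL q_pp cardF TP.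
have [tab _ _ _ _] := fr.
have [th memS] := splash_frame PL Pl fr Tt.
have K0 := subfield0 (subfield_order_frob_fixed q_pp cardF).
have [c nzc tE] := eqmx_vec Tt Tt0.
have combE k : comb3 t a b k th 1 = k *: t + comb3 t a b 0 th 1.
  by rewrite /comb3 scale0r add0r addrA.
have [x [z [nzz u0E]]] : exists x z,
    z != 0 /\ u0 = x *: t + z *: comb3 t a b 0 th 1.
  have nz0 : comb3 t a b 0 th 1 != 0.
    by rewrite comb3_neq0 // /nz3 oner_eq0 !andbF.
  have [X0 X0E] := vec_point nz0.
  (* The splash point with [k1 = k2 = 0] lies on [l], which yields the relation between [th] and the
     equation of [l]. *)
  have /andP[X0l _] : incident X0 l && [exists m in L, incident X0 m].
    by apply/memS; right; exists 0, 0; rewrite mul0r addr0.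
  have [d [e [f [nzl le]]]] := line_coord l tab.
  have tl : (t <= l)%MS.
    by rewrite -(incident_vec _ Tt); have := set11 T; rewrite -Pl inE => /andP[].
  have d0 : d = 0.
    have t_comb : comb3 t a b 1 0 0 = t by rewrite /comb3 !scale0r !addr0 scale1r.
    by move: tl; rewrite -t_comb le mulr1 !mulr0 !addr0 => /eqP.
  move: X0l; rewrite (incident_vec _ X0E) le d0 !mul0r add0r mulr1 => /eqP fE.
  have [x [y [z uE]]] := span3 tab u0; exists x, z.
  move: u0l; rewrite uE le d0 mul0r add0r => eyz.
  have fNe : f = - (e * th) by apply/eqP; rewrite -addr_eq0 addrC fE.
  have nze : e != 0.
    apply: contraNneq nzl => e0; rewrite fNe e0 mul0r oppr0 d0.
    by rewrite /nz3 eqxx.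
  have yE : y = z * th.
    apply/eqP; rewrite -subr_eq0; move: eyz; rewrite fNe.
    have -> : e * y + - (e * th) * z = e * (y - z * th) by ring.
    by rewrite mulf_eq0 (negPf nze).
  split; last by rewrite yE /comb3 scale0r add0r scale1r scalerDr scalerA addrA.
  apply: contraNneq nu0 => z0; rewrite uE yE z0 mul0r /comb3 !scale0r !addr0 tE.
  by rewrite scalerA scalemx_sub.
exists (- (x * c)), (z * c), th => X; rewrite inE.
apply: (iff_trans (memS X)).
have vE k : comb3 t a b k th 1 = z^-1 *: (u0 + (- (x * c) + z * c * k) *: t0).
  apply: (scalerI nzz); rewrite scalerA divff // scale1r combE scalerDr.
  rewrite u0E tE !scalerA addrAC -scalerDl; congr (_ *: _ + _); ring.
split; (case=> [Xt|[k1 [k2 [k1K k2K Xk]]]]; [left|right; exists k1, k2; split=> //]).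
- by rewrite tE eqmx_scale_vec in Xt.
- by rewrite vE eqmx_scale_vec ?invr_eq0 in Xk.
- by rewrite tE eqmx_scale_vec.
- by rewrite vE eqmx_scale_vec ?invr_eq0.
Qed.

End Splash.

(** * Subplanes from bases *)

Section Model.
Variables (F : finFieldType) (q : nat) (K : {set F}).
Hypothesis Kq : subfield_of_order q K.
Variables t a b : 'rV[F]_3.
Hypothesis tab : free3 t a b.
Implicit Types (x y z c d e f : F) (m n : line F) (X Y Z : point F).

(** Together with [model_lines], the copy of PG(2,K) on the basis [t], [a], [b]. *)
Definition model_points : {set point F} :=
  [set X : point F | [exists x in K, exists y in K, exists z in K,
    (X == comb3 t a b x y z)%MS]].

Definition model_lines : {set line F} :=
  [set m : line F | [exists d in K, exists e in K, exists f in K,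
    nz3 d e f && [forall x, forall y, forall z,
      (comb3 t a b x y z <= m)%MS == (d * x + e * y + f * z == 0)%R]]].

Lemma model_pointsP X : reflect
  (exists x y z, [/\ x \in K, y \in K, z \in K & (X == comb3 t a b x y z)%MS])
  (X \in model_points).
Proof.
rewrite inE; apply: (iffP exists_inP) => [[x xK /exists_inP[y yK]]|].
  by case/exists_inP => z zK Xx; exists x, y, z.
case=> x [y [z [xK yK zK Xx]]]; exists x => //; apply/exists_inP.
by exists y => //; apply/exists_inP; exists z.
Qed.

Lemma model_linesP m : reflect
  (exists d e f, [/\ d \in K, e \in K, f \in K, nz3 d e f & line_eq t a b m d e f])
  (m \in model_lines).
Proof.
rewrite inE; apply: (iffP exists_inP) => [[d dK /exists_inP[e eK]]|].
  case/exists_inP => f fK /andP[nz /forallP mE]; exists d, e, f; split=> //.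
  by move=> x y z; have /forallP/(_ y)/forallP/(_ z)/eqP := mE x.
case=> d [e [f [dK eK fK nz mE]]]; exists d => //; apply/exists_inP.
exists e => //; apply/exists_inP; exists f; rewrite // nz /=.
by do 3!apply/forallP => ?; apply/eqP/mE.
Qed.

Let K1 := subfield1 Kq.
Let K0 := subfield0 Kq.
Let KB := subfieldB Kq.
Let KN := subfieldN Kq.
Let KD := subfieldD Kq.
Let KM := subfieldM Kq.
Let Kdiv := subfield_div Kq.

(** The joining line is given by the cross product, whose entries stay in [K]; any other line
    through both points has proportional coordinates. *)
Lemma model_join X Y : X \in model_points -> Y \in model_points -> X != Y ->
  exists! m, [/\ m \in model_lines, incident X m & incident Y m].
Proof.
move=> /model_pointsP[x1 [x2 [x3 [x1K x2K x3K Xx]]]].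
move=> /model_pointsP[y1 [y2 [y3 [y1K y2K y3K Yy]]]] neqXY.
have nz Z z1 z2 z3 : (Z == comb3 t a b z1 z2 z3)%MS -> nz3 z1 z2 z3.
  move=> Zz; rewrite -(comb3_neq0 _ _ _ tab) -mxrank_eq0.
  by rewrite -(eqmx_rank Zz) mxrank_subspace.
have nzc : nz3 (x2 * y3 - x3 * y2) (x3 * y1 - x1 * y3) (x1 * y2 - x2 * y1).
  apply: contraNT neqXY => /(cross0_prop (nz _ _ _ _ Xx) (nz _ _ _ _ Yy)).
  case=> k nzk [y1E y2E y3E]; apply/eqP/(eq_point Xx).
  by rewrite y1E y2E y3E comb3_scale eqmx_scale_vec in Yy.
have [m mE] := line_exists tab nzc; exists m; split.
  split; rewrite ?(incident_vec _ Xx) ?(incident_vec _ Yy) ?mE; first 1 last.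
  - by apply/eqP; ring.
  - by apply/eqP; ring.
  apply/model_linesP.
  exists (x2 * y3 - x3 * y2), (x3 * y1 - x1 * y3), (x1 * y2 - x2 * y1).
  by split; rewrite // KB ?KM.
move=> m' [_]; rewrite (incident_vec _ Xx) (incident_vec _ Yy).
have [d [e [f [nzd m'E]]]] := line_coord m' tab.
rewrite !m'E => /eqP xd /eqP yd.
have xd' : x1 * d + x2 * e + x3 * f = 0 by rewrite -xd; ring.
have yd' : y1 * d + y2 * e + y3 * f = 0 by rewrite -yd; ring.
have [||k nzk [dE eE fE]] := orth3_prop nzc _ _ xd' yd' nzc nzd; try by ring.
rewrite dE eE fE in m'E.
by apply: line_eq_inj tab _ m'E; apply: line_eq_scale.
Qed.

Lemma model_meet m n : m \in model_lines -> n \in model_lines -> m != n ->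
  exists! X, [/\ X \in model_points, incident X m & incident X n].
Proof.
move=> /model_linesP[x1 [x2 [x3 [x1K x2K x3K nzx mE]]]].
move=> /model_linesP[y1 [y2 [y3 [y1K y2K y3K nzy nE]]]] neqmn.
have nzc : nz3 (x2 * y3 - x3 * y2) (x3 * y1 - x1 * y3) (x1 * y2 - x2 * y1).
  apply: contraNT neqmn => /(cross0_prop nzx nzy)[k nzk [y1E y2E y3E]].
  rewrite y1E y2E y3E in nE.
  by apply/eqP/(line_eq_inj tab _ nE)/line_eq_scale.
have nzv := nzc; rewrite -(comb3_neq0 _ _ _ tab) in nzv.
have [X Xc] := vec_point nzv; exists X; split.
  split; rewrite ?(incident_vec _ Xc) ?mE ?nE; first 1 last.
  - by apply/eqP; ring.
  - by apply/eqP; ring.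
  apply/model_pointsP.
  exists (x2 * y3 - x3 * y2), (x3 * y1 - x1 * y3), (x1 * y2 - x2 * y1).
  by split; rewrite // KB ?KM.
move=> X' [_]; have [v nzw X'v] := point_vec X'.
have [d [e [f vE]]] := span3 tab v; rewrite {}vE comb3_neq0 // in nzw X'v.
rewrite !(incident_vec _ X'v) mE nE => /eqP xd /eqP yd.
have [||k nzk [dE eE fE]] := orth3_prop nzc _ _ xd yd nzc nzw; try by ring.
by apply: (eq_point Xc); rewrite dE eE fE comb3_scale eqmx_scale_vec in X'v.
Qed.

(** The basis points and the unit point lie on the line (d, e, f) when d, e, f or d + e + f is zero,
    respectively. At most two of these vanish unless all do. *)
Lemma model_quadrangle : exists Q : {set point F},
  [/\ Q \subset model_points, #|Q| = 4%N &
    forall m, m \in model_lines -> (#|[set X in Q | incident X m]| <= 2)%N].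
Proof.
have pt x y z : nz3 x y z -> exists X : point F, (X == comb3 t a b x y z)%MS.
  by rewrite -(comb3_neq0 _ _ _ tab) => /vec_point.
have [|X1 X1E] := pt 1 0 0; first by rewrite /nz3 oner_eq0.
have [|X2 X2E] := pt 0 1 0; first by rewrite /nz3 oner_eq0 andbF.
have [|X3 X3E] := pt 0 0 1; first by rewrite /nz3 oner_eq0 !andbF.
have [|X4 X4E] := pt 1 1 1; first by rewrite /nz3 oner_eq0.
pose s := [:: X1; X2; X3; X4]; exists [set:: s]; split.
- apply/subsetP => X; rewrite in_set !in_cons in_nil orbF.
  case/or4P => /eqP->; apply/model_pointsP.
  + by exists 1, 0, 0.
  + by exists 0, 1, 0.
  + by exists 0, 0, 1.
  + by exists 1, 1, 1.
- rewrite cardsE; apply: (card_uniqP (_ : uniq s)).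
  rewrite /= !inE !negb_or -!andbA /= !andbT.
  do ![apply/andP; split=> //];
    first [apply: (point_neq tab X1E X2E) | apply: (point_neq tab X1E X3E)
      | apply: (point_neq tab X1E X4E) | apply: (point_neq tab X2E X3E)
      | apply: (point_neq tab X2E X4E) | apply: (point_neq tab X3E X4E)];
    rewrite /nz3 ?(mul0r, mulr0, mul1r, mulr1, subr0, sub0r, subrr, oppr_eq0)
      oner_eq0 ?andbF //.
move=> m /model_linesP[d [e [f [dK eK fK nz mE]]]].
have -> : [set X in [set:: s] | incident X m] =
    [set:: [seq X <- s | incident X m]].
  by apply/setP => X; rewrite !in_set mem_filter andbC.
rewrite cardsE; apply: leq_trans (card_size _) _; rewrite size_filter /=.
rewrite (incident_vec _ X1E) (incident_vec _ X2E) (incident_vec _ X3E).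
rewrite (incident_vec _ X4E) !mE !mulr1 !mulr0 !addr0 !add0r.
move: nz; rewrite /nz3.
have [->|nd] := eqVneq d 0; have [->|ne] := eqVneq e 0;
  have [->|nf] := eqVneq f 0 => //= _; rewrite ?add0r ?addr0 ?eqxx;
  by rewrite ?(negPf nd) ?(negPf ne) ?(negPf nf) //; case: eqP.
Qed.

(* u and v form a K-basis of the solutions in K^3 of d x + e y + f z = 0. *)
Definition K_basis d e f u1 u2 u3 v1 v2 v3 :=
  [/\ forall x y, x \in K -> y \in K -> [/\ x * u1 + y * v1 \in K,
        x * u2 + y * v2 \in K & x * u3 + y * v3 \in K],
      forall x y, d * (x * u1 + y * v1) + e * (x * u2 + y * v2) +
        f * (x * u3 + y * v3) = 0,
      forall x y, x * u1 + y * v1 = 0 -> x * u2 + y * v2 = 0 ->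
        x * u3 + y * v3 = 0 -> x = 0 /\ y = 0
    & forall x y z, x \in K -> y \in K -> z \in K ->
        d * x + e * y + f * z = 0 -> exists c c', [/\ c \in K, c' \in K &
        [/\ x = c * u1 + c' * v1, y = c * u2 + c' * v2 & z = c * u3 + c' * v3]]].

Lemma K_basis_rot d e f u1 u2 u3 v1 v2 v3 :
  K_basis d e f u1 u2 u3 v1 v2 v3 -> K_basis e f d u2 u3 u1 v2 v3 v1.
Proof.
case=> inK orth indep sol; split=> [x y xK yK|x y|x y e1 e2 e3|x y z xK yK zK e0].
- by case: (inK x y).
- by rewrite -[RHS](orth x y); ring.
- exact: indep.
have [|c [c' [cK c'K [-> -> ->]]]] := sol z x y zK xK yK.
  by rewrite -e0; ring.
by exists c, c'.
Qed.

(** If [d] is nonzero, the equation is solved for the first coordinate; the other cases follow by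
    cyclic rotation. *)
Lemma K_basis_exists d e f : d \in K -> e \in K -> f \in K -> nz3 d e f ->
  exists u1 u2 u3 v1 v2 v3, K_basis d e f u1 u2 u3 v1 v2 v3.
Proof.
have base d' e' f' : d' \in K -> e' \in K -> f' \in K -> d' != 0 ->
    K_basis d' e' f' (- (e' / d')) 1 0 (- (f' / d')) 0 1.
  move=> dK eK fK nzd; split=> [x y xK yK|x y|x y _|x y z xK yK zK e0].
  - by rewrite !mulr1 !mulr0 addr0 add0r KD ?KM ?KN ?Kdiv.
  - by field.
  - by rewrite !mulr1 !mulr0 addr0 add0r.
  exists y, z; split; rewrite // !mulr1 !mulr0 addr0 add0r; split=> //.
  apply: (mulfI nzd); apply/eqP; rewrite -subr_eq0; apply/eqP.
  by rewrite -e0; field.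
move=> dK eK fK /nz3P[] nz.
- by do 6!eexists; apply: base.
- by do 6!eexists; do 2!apply: K_basis_rot; apply: base.
- by do 6!eexists; apply: K_basis_rot; apply: base.
Qed.

Lemma comb3_lin x y u1 u2 u3 v1 v2 v3 :
  x *: comb3 t a b u1 u2 u3 + y *: comb3 t a b v1 v2 v3 =
  comb3 t a b (x * u1 + y * v1) (x * u2 + y * v2) (x * u3 + y * v3).
Proof.
rewrite -!comb3_scale /comb3 !scalerDl (addrACA (_ + _)) (addrACA (_ *: t)).
by [].
Qed.

(** The points on [m] are spanned by [c *: u + c' *: v] with coefficients in [K]: this is [u] for
    [c' = 0] and [v + (c / c') *: u] otherwise. *)
Lemma model_order m : m \in model_lines ->
  #|[set X in model_points | incident X m]| = q.+1.
Proof.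
move=> /model_linesP[d [e [f [dK eK fK nz mE]]]].
have [u1 [u2 [u3 [v1 [v2 [v3 [inK orth indep sol]]]]]]] :=
  K_basis_exists dK eK fK nz.
have [_ <-] := Kq; set u := comb3 t a b u1 u2 u3; set v := comb3 t a b v1 v2 v3.
apply: (@card_affine_line _ _ u v) => [x y|X].
  by rewrite addrC comb3_lin => /tab[e1 e2 e3]; have [] := indep _ _ e1 e2 e3.
have memX x y : x \in K -> y \in K -> (X == (x *: u + y *: v)%R)%MS ->
    X \in [set X in model_points | incident X m].
  rewrite comb3_lin => xK yK Xxy; rewrite in_set (incident_vec _ Xxy) mE orth eqxx.
  have [e1 e2 e3] := inK _ _ xK yK; rewrite andbT; apply/model_pointsP.
  by do 3!eexists; split; last exact: Xxy.
split=> [|[Xu|[c cK Xc]]].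
- rewrite in_set => /andP[/model_pointsP[x [y [z [xK yK zK Xx]]]]].
  rewrite (incident_vec _ Xx) mE => /eqP e0.
  have [c [c' [cK c'K [xE yE zE]]]] := sol _ _ _ xK yK zK e0.
  rewrite xE yE zE -comb3_lin -/u -/v in Xx.
  have nzX : c *: u + c' *: v != 0.
    by rewrite -mxrank_eq0 -(eqmx_rank Xx) mxrank_subspace.
  have [c'0|nzc'] := eqVneq c' 0.
    move: Xx nzX; rewrite c'0 scale0r addr0 => Xx nzX; left.
    by rewrite eqmx_scale_vec // in Xx; apply: contraNneq nzX => ->; rewrite scale0r.
  right; exists (c / c'); first exact: Kdiv.
  rewrite -(eqmx_scale_vec _ _ nzc') scalerDr scalerA mulrC divfK //.
  by rewrite addrC.
- by apply: (memX 1 0) => //; rewrite scale1r scale0r addr0.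
- by apply: (memX c 1) => //; rewrite scale1r addrC.
Qed.

Lemma model_subplane : subplane q model_points model_lines.
Proof.
by split; [exact: model_join|exact: model_meet|exact: model_quadrangle
  |exact: model_order].
Qed.

End Model.

(** * The affine line without the centre *)

Section AffineLine.
Variables (F : finFieldType) (q : nat).
Implicit Types (t a b u v w : 'rV[F]_3) (x y z c d e f k : F) (m l : line F).
Implicit Types (X Y T : point F) (S : {set point F}).

Hypothesis q_pp : exists p k : nat, [/\ prime p, (0 < k)%N & q = (p ^ k)%N].
Hypothesis cardF : #|F| = (q ^ 3)%N.
Let K := frob_fixed F q.

Let Kq := subfield_order_frob_fixed q_pp cardF.
Let K1 := subfield1 Kq.
Let K0 := subfield0 Kq.
Let KB := subfieldB Kq.
Let KN := subfieldN Kq.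
Let KD := subfieldD Kq.
Let KM := subfieldM Kq.
Let Kdiv := subfield_div Kq.

Variables (l : line F) (T : point F) (t u : 'rV[F]_3).
Hypotheses (Tt : (T == t)%MS) (tl : (t <= l)%MS) (ul : (u <= l)%MS).
Hypothesis ut : ~~ (u <= t)%MS.

Let nzt : t != 0.
Proof. by rewrite -mxrank_eq0 -(eqmx_rank Tt) mxrank_subspace. Qed.

Lemma tu_free x y : x *: t + y *: u = 0 -> x = 0 /\ y = 0.
Proof.
move=> e; have y0 : y = 0.
  apply: contraNeq ut => nzy; rewrite -(eqmx_scale u nzy).
  have -> : y *: u = - x *: t.
    by apply/eqP; rewrite scaleNr -addr_eq0 addrC e.
  by rewrite scalemx_sub.
move: e; rewrite y0 scale0r addr0 => /eqP.
by rewrite scaler_eq0 (negPf nzt) orbF => /eqP.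
Qed.

Lemma line_span v : (v <= l)%MS -> exists x y, v = x *: t + y *: u.
Proof.
have tul : (t + u <= l)%MS by rewrite addsmx_sub tl ul.
have rk2 : \rank (t + u)%MS = 2%N.
  have rkl := mxrankS tul; rewrite mxrank_subspace in rkl.
  apply/eqP; rewrite eqn_leq rkl /=.
  have : (t < t + u)%MS by rewrite ltmxE addsmxSl addsmx_sub submx_refl ut.
  by move/rank_ltmx; rewrite rank_rV nzt.
have := mxrank_leqif_eq tul => -[_]; rewrite rk2 mxrank_subspace eqxx.
move/esym/eqmxP => tuE; rewrite -tuE => /sub_addsmxP[[D E] /= ->].
exists (D 0 0), (E 0 0); rewrite [D]mx11_scalar [E]mx11_scalar !mul_scalar_mx.
by rewrite !mxE /= !mulr1n.
Qed.

Lemma affine_coord X : incident X l -> X != T ->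
  exists x, (X == (u + x *: t)%R)%MS.
Proof.
have [v nzv Xv] := point_vec X; rewrite (incident_vec _ Xv).
move=> /line_span[x [y vE]] neqXT; rewrite vE in Xv nzv.
have [y0|nzy] := eqVneq y 0.
  rewrite y0 scale0r addr0 in Xv nzv.
  have nzx : x != 0 by apply: contraNneq nzv => ->; rewrite scale0r.
  rewrite eqmx_scale_vec // in Xv.
  by rewrite (eq_point Xv Tt) eqxx in neqXT.
exists (y^-1 * x); rewrite -(eqmx_scale_vec _ _ nzy) scalerDr scalerA mulVKf //.
by rewrite addrC.
Qed.

Lemma affine_coord_inj X x y :
  (X == (u + x *: t)%R)%MS -> (X == (u + y *: t)%R)%MS -> x = y.
Proof.
move=> Xx Xy; have [k _ e] := eqmx_vec Xx Xy.
have [] := @tu_free (x - k * y) (1 - k).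
  rewrite !scalerBl scale1r -scalerA addrACA (addrC (x *: t)) e scalerDr.
  by rewrite -opprD (addrC (k *: u)) subrr.
by move=> /subr0_eq -> /subr0_eq <-; rewrite mul1r.
Qed.

Lemma affine_neq_center X x : (X == (u + x *: t)%R)%MS -> ~ (X == t)%MS.
Proof.
move=> Xx Xt; have [k _ e] := eqmx_vec Xx Xt.
have [] := @tu_free (x - k) 1; last by move=> _ /eqP; rewrite oner_eq0.
by rewrite scalerBl scale1r addrAC (addrC (x *: t)) e subrr.
Qed.

(** The subline is PG(1,K) on the basis [x *: t], [u]. The factor [x] puts the point of affine
    coordinate [x] at (1 : 1). *)
Lemma subline_exists x : x != 0 -> exists S, subline q l S /\
  forall X c d, c \in K -> d \in K ->
    (X == (c *: (x *: t) + d *: u)%R)%MS -> X \in S.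
Proof.
move=> nzx.
exists (proj_image (col_mx (x *: t) u) (proj_image 1%:M (PG1 K))); split.
  exists (col_mx (x *: t) u), (proj_image 1%:M (PG1 K)); split=> //.
    have Bl : (col_mx (x *: t) u <= l)%MS by rewrite col_mx_sub scalemx_sub.
    apply/andP; split; first exact: Bl.
    apply/rV_subP => v /line_span[y [z ->]].
    have <- : row_mx (y / x)%:M z%:M *m col_mx (x *: t) u = y *: t + z *: u.
      by rewrite mul_row_col !mul_scalar_mx scalerA divfK.
    exact: submxMl.
  by exists K, 1%:M; split; rewrite // unitmx1.
move=> X c d cK dK Xcd.
pose v : 'rV[F]_2 := row_mx c%:M d%:M.
have vE : v *m col_mx (x *: t) u = c *: (x *: t) + d *: u.
  have <- : row_mx c%:M d%:M *m col_mx (x *: t) u = c *: (x *: t) + d *: u.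
    by rewrite mul_row_col !mul_scalar_mx.
  by [].
have nzv : v != 0.
  have : c *: (x *: t) + d *: u != 0.
    by rewrite -mxrank_eq0 -(eqmx_rank Xcd) mxrank_subspace.
  by apply: contraNneq => v0; rewrite -vE v0 mul0mx.
have [Y Yv] := vec_point nzv.
rewrite in_set; apply/exists_inP; exists Y.
  rewrite in_set; apply/exists_inP; exists Y; last by rewrite mulmx1; apply/eqmxP.
  rewrite in_set; apply/existsP; exists v; rewrite nzv Yv andbT /=.
  apply/forallP => i; rewrite !mxE.
  by case: splitP => j _; rewrite !mxE ord1 mulr1n.
rewrite -vE in Xcd; apply/eqmxP/(eqmx_trans (eqmxP Xcd))/eqmx_sym.
exact/eqmxMr/eqmxP.
Qed.

(** The affine coordinates of [S] form an affine K-plane through 0, [x1] and [x2], which must be the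
    K-span of [x1] and [x2]. As the resulting description does not involve [S], it yields
    uniqueness. *)
Lemma tangent_splash_through S x1 x2 :
  tangent_splash q l T S ->
  (forall k1 k2, k1 \in K -> k2 \in K -> k1 * x1 + k2 * x2 = 0 ->
     k1 = 0 /\ k2 = 0) ->
  (forall X, (X == u)%MS -> X \in S) ->
  (forall X, (X == (u + x1 *: t)%R)%MS -> X \in S) ->
  (forall X, (X == (u + x2 *: t)%R)%MS -> X \in S) ->
  forall X, X \in S <-> (X == t)%MS \/ exists k1 k2,
    [/\ k1 \in K, k2 \in K & (X == (u + (k1 * x1 + k2 * x2) *: t)%R)%MS].
Proof.
move=> splS indep SU SV SW X.
have [be [ga [th memS]]] := splash_affine q_pp cardF splS Tt ul ut.
pose f (k : F * F) := be + ga * (k.1 + k.2 * th).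
pose g (k : F * F) := k.1 * x1 + k.2 * x2.
have inD x : (forall Y, (Y == (u + x *: t)%R)%MS -> Y \in S) -> x \in f @: setX K K.
  move=> SY; have nzx : u + x *: t != 0.
    apply/eqP => e; have [] := @tu_free x 1; first by rewrite scale1r addrC.
    by move=> _ /eqP; rewrite oner_eq0.
  have [Y Yx] := vec_point nzx.
  have /memS[Yt|[k1 [k2 [k1K k2K Yk]]]] := SY Y Yx.
    by case: (affine_neq_center Yx Yt).
  by apply/imsetP; exists (k1, k2); [rewrite in_setX k1K|exact: affine_coord_inj Yx Yk].
have /imsetP[[c1 c2] c_K] : 0 \in f @: setX K K.
  by apply: inD => Y; rewrite scale0r addr0; apply: SU.
have /imsetP[[a1 a2] a_K x1E] := inD _ SV.
have /imsetP[[b1 b2] b_K x2E] := inD _ SW.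
rewrite !in_setX /= in c_K a_K b_K.
case/andP: c_K => c1K c2K; case/andP: a_K => a1K a2K; case/andP: b_K => b1K b2K.
rewrite /f /= => /esym/eqP; rewrite addr_eq0 => /eqP beE.
(* Both are K-planes; the second one is only known to have at most q^2 elements. *)
have gf : g @: setX K K = f @: setX K K.
  apply/eqP; rewrite eqEcard; apply/andP; split.
    apply/subsetP => _ /imsetP[[k1 k2] + ->]; rewrite in_setX /= => /andP[k1K k2K].
    apply/imsetP.
    (* Combine the differences of the parameters of [x1] and [x2] from those of 0, then shift back
       by the parameters [c1], [c2] of 0. *)
    exists (k1 * (a1 - c1) + k2 * (b1 - c1) + c1, k1 * (a2 - c2) + k2 * (b2 - c2) + c2).
      by rewrite in_setX /=; apply/andP; split; rewrite KD // KD // KM // KB.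
    by rewrite /g /= x1E x2E /f /= beE; ring.
  rewrite (leq_trans (leq_imset_card _ _)) // card_in_imset //.
  move=> [k1 k2] [k1' k2']; rewrite !in_setX /= => /andP[k1K k2K] /andP[k1'K k2'K].
  rewrite /g /= => e; have [] := indep (k1 - k1') (k2 - k2'); rewrite ?KB //.
    by rewrite !mulrBl addrACA e -opprD subrr.
  by move=> /subr0_eq -> /subr0_eq ->.
apply: (iff_trans (memS X)); split; (case=> [Xt|[k1 [k2 [k1K k2K Xk]]]]; first by left).
  right; have : f (k1, k2) \in g @: setX K K.
    by rewrite gf imset_f // in_setX /= k1K.
  case/imsetP => [[k1' k2']]; rewrite in_setX /= => /andP[k1'K k2'K] e.
  by exists k1', k2'; split; rewrite // -/(g (k1', k2')) -e.
right; have : g (k1, k2) \in f @: setX K K.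
  by rewrite -gf imset_f // in_setX /= k1K.
case/imsetP => [[k1' k2']]; rewrite in_setX /= => /andP[k1'K k2'K] e.
by exists k1', k2'; split; rewrite // -/(f (k1', k2')) -e.
Qed.

(** With [a] off [l], the basis [x2 *: t], [a], [u - th *: a] gives [l] the equation y = th z. Since
    [th] is not in [K], the copy of PG(2,K) on this basis meets [l] only in [T], and its splash is
    the one sought. *)
Lemma tangent_splash_exists x1 x2 : x2 != 0 -> x1 / x2 \notin K ->
  exists S, tangent_splash q l T S /\ (forall X,
    [\/ (X == t)%MS, (X == u)%MS, (X == (u + x1 *: t)%R)%MS
      | (X == (u + x2 *: t)%R)%MS] -> X \in S).
Proof.
move=> nzx2; set th := x1 / x2 => thK.
have [a al] : exists a, ~~ (a <= l)%MS.
  have /row_subPn[i ail] : ~~ ((1%:M : 'M[F]_3) <= l)%MS.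
    by apply/negP => /mxrankS; rewrite mxrank1 mxrank_subspace.
  by exists (row i 1%:M).
pose t' := x2 *: t; pose b := u - th *: a.
have combE x y z : comb3 t' a b x y z = (x *: t' + z *: u) + (y - z * th) *: a.
  rewrite /comb3 /b scalerBr scalerBl (scalerA z) -!addrA; congr (_ + _).
  by rewrite addrCA.
have comb_l x y z : (comb3 t' a b x y z <= l)%MS = (y == z * th).
  have sl : ((x *: t' + z *: u)%R <= l)%MS by rewrite addmx_sub ?scalemx_sub.
  rewrite combE -subr_eq0; apply/idP/eqP => [h|->]; last by rewrite scale0r addr0.
  apply: contraNeq al => nz; rewrite -(eqmx_scale a nz).
  by rewrite -[X in (X <= _)%MS](addKr (x *: t' + z *: u)) addmx_sub // eqmx_opp.
have tab : free3 t' a b.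
  move=> x y z e; have yE : y = z * th.
    by apply/eqP; rewrite -(comb_l x) e sub0mx.
  move: e; rewrite combE yE subrr scale0r addr0 scalerA => /tu_free[xx2 z0].
  move/eqP: xx2; rewrite mulf_eq0 (negPf nzx2) orbF => /eqP->.
  by rewrite z0 mul0r.
have Tt' : (T == comb3 t' a b 1 0 0)%MS.
  by rewrite /comb3 scale1r !scale0r !addr0 eqmx_scale_vec.
pose P := model_points K t' a b; pose L := model_lines K t' a b.
pose S := [set X : point F | incident X l & [exists m in L, incident X m]].
have memS X x y z d e f : (X == comb3 t' a b x y z)%MS -> y = z * th ->
    d \in K -> e \in K -> f \in K -> nz3 d e f -> d * x + e * y + f * z = 0 ->
    X \in S.
  move=> Xx yE dK eK fK nz e0; rewrite in_set (incident_vec _ Xx) comb_l yE eqxx /=.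
  have [m mE] := line_exists tab nz; apply/exists_inP; exists m.
    by apply/model_linesP; exists d, e, f.
  by rewrite (incident_vec _ Xx) mE e0.
exists S; split.
  exists P, L; split=> //; first exact: model_subplane.
  apply/setP => X; rewrite in_set in_set1; apply/andP/eqP => [|->].
    case=> /model_pointsP[x [y [z [xK yK zK Xx]]]].
    rewrite (incident_vec _ Xx) comb_l => /eqP yE.
    (* Otherwise [th = y / z] would be a quotient of elements of [K]. *)
    have z0 : z = 0.
      by apply: contraNeq thK => nzz; rewrite -(mulKf nzz th) -yE mulrC Kdiv.
    rewrite yE z0 mul0r in Xx.
    have nzx : x != 0.
      apply/eqP => x0; have := mxrank_subspace X.
      by rewrite (eqmx_rank Xx) x0 /comb3 !scale0r !addr0 mxrank0.
    by apply: eq_point Tt'; rewrite -(eqmx_scale_vec _ _ nzx) -comb3_scale mulr1 mulr0.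
  split; last by rewrite (incident_vec _ Tt).
  by apply/model_pointsP; exists 1, 0, 0.
have thE : th * x2 = x1 by rewrite /th divfK.
(* The four points are (1 : 0 : 0), (0 : th : 1), (th : th : 1) and (1 : th : 1), on the model lines
   y = 0, x = 0, x = y and x = z. *)
move=> X [] Xv.
- apply: (@memS X 1 0 0 0 1 0) => //; rewrite ?(mul0r, mulr0, addr0) //.
    by rewrite (eq_point Xv Tt).
  by rewrite /nz3 oner_eq0 andbF.
- apply: (@memS X 0 th 1 1 0 0) => //; rewrite ?(mul1r, mul0r, mulr0, addr0) //.
    by rewrite combE mul1r subrr !scale0r add0r addr0 scale1r.
  by rewrite /nz3 oner_eq0.
- apply: (@memS X th th 1 1 (-1) 0) => //; rewrite ?KN ?mul1r //.
  + by rewrite combE mul1r subrr scale0r addr0 scale1r scalerA thE addrC.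
  + by rewrite /nz3 oner_eq0.
  + by ring.
- apply: (@memS X 1 th 1 1 0 (-1)) => //; rewrite ?KN ?mul1r //.
  + by rewrite combE mul1r subrr scale0r addr0 !scale1r addrC.
  + by rewrite /nz3 oner_eq0.
  + by ring.
Qed.

End AffineLine.

(** * Existence and uniqueness of the splash through four points *)

Theorem theorem5p5 (q : nat)
    (q_pp : exists p k : nat, [/\ prime p, (0 < k)%N & q = (p ^ k)%N])
    (F : finFieldType) (cardF : #|F| = (q ^ 3)%N)
    (l : line F) (T U V W : point F)
    (Tl : incident T l) (Ul : incident U l)
    (Vl : incident V l) (Wl : incident W l)
    (TUVW_distinct : uniq [:: T; U; V; W])
    (not_cosublinear :
       ~ exists S : {set point F}, subline q l S /\ [set T; U; V; W] \subset S) :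
  exists! S : {set point F},
    tangent_splash q l T S /\ [set T; U; V; W] \subset S.
Proof.
move: TUVW_distinct; rewrite /= !inE !negb_or -!andbA.
case/and5P => nTU nTV nTW nUV /and3P[nUW nVW _].
(* On [l] take the affine coordinate with [T] at infinity and [U] as origin; [x1] and [x2] will be
   the coordinates of [V] and [W]. *)
have [t nzt Tt] := point_vec T; have [u nzu Uu] := point_vec U.
have tl : (t <= l)%MS by rewrite -(incident_vec _ Tt).
have ul : (u <= l)%MS by rewrite -(incident_vec _ Uu).
have ut : ~~ (u <= t)%MS.
  apply: contra nTU => /sub_rVP[k uE]; rewrite uE in Uu nzu.
  rewrite eqmx_scale_vec in Uu; first by rewrite (eq_point Tt Uu).
  by apply: contraNneq nzu => ->; rewrite scale0r.
have [x1 Vx1] : exists x, (V == (u + x *: t)%R)%MS.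
  by apply: (affine_coord Tt tl ul ut) => //; rewrite eq_sym.
have [x2 Wx2] : exists x, (W == (u + x *: t)%R)%MS.
  by apply: (affine_coord Tt tl ul ut) => //; rewrite eq_sym.
have nzx2 : x2 != 0.
  by apply: contraNneq nUW => x20; rewrite x20 scale0r addr0 in Wx2;
    rewrite (eq_point Uu Wx2).
have Kq := subfield_order_frob_fixed q_pp cardF.
have [K0 K1] := (subfield0 Kq, subfield1 Kq).
have x12K : x1 / x2 \notin frob_fixed F q.
  (* The subline with [T], [U], [W] at (1 : 0), (0 : 1), (1 : 1) would contain [V], at (x1 / x2 :
     1). *)
  apply/negP => x12K; apply: not_cosublinear.
  have [S [subS memS]] := subline_exists q_pp cardF Tt tl ul ut nzx2.
  exists S; split=> //; apply/subsetP => X; rewrite !inE -!orbA => /or4P[]/eqP->.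
  - by apply: (memS _ 1 0); rewrite // scale1r scale0r addr0 eqmx_scale_vec.
  - by apply: (memS _ 0 1); rewrite // scale1r scale0r add0r.
  - by apply: (memS _ (x1 / x2) 1); rewrite // scale1r scalerA divfK // addrC.
  - by apply: (memS _ 1 1); rewrite // !scale1r addrC.
have indep k1 k2 : k1 \in frob_fixed F q -> k2 \in frob_fixed F q ->
    k1 * x1 + k2 * x2 = 0 -> k1 = 0 /\ k2 = 0.
  move=> k1K k2K e; have k10 : k1 = 0.
    apply: contraNeq x12K => nzk1.
    have -> : x1 / x2 = - k2 / k1.
      by apply/eqP; rewrite eqr_div // mulNr -addr_eq0 mulrC e.
    by rewrite (subfield_div Kq) ?(subfieldN Kq).
  move: e; rewrite k10 mul0r add0r => /eqP.
  by rewrite mulf_eq0 (negPf nzx2) orbF => /eqP.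
have through S : tangent_splash q l T S -> [set T; U; V; W] \subset S ->
    forall X, X \in S <-> (X == t)%MS \/ exists k1 k2,
      [/\ k1 \in frob_fixed F q, k2 \in frob_fixed F q
        & (X == (u + (k1 * x1 + k2 * x2) *: t)%R)%MS].
  move=> splS /subsetP sub.
  apply: (tangent_splash_through q_pp cardF Tt ul ut splS indep) => X Xv.
  - by rewrite (eq_point Xv Uu) sub // !inE eqxx !orbT.
  - by rewrite (eq_point Xv Vx1) sub // !inE eqxx !orbT.
  - by rewrite (eq_point Xv Wx2) sub // !inE eqxx !orbT.
have [S [splS memS]] := tangent_splash_exists q_pp cardF Tt tl ul ut nzx2 x12K.
have subS : [set T; U; V; W] \subset S.
  apply/subsetP => X; rewrite !inE -!orbA => /or4P[]/eqP->; apply: memS.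
  - exact: Or41.
  - exact: Or42.
  - exact: Or43.
  - exact: Or44.
exists S; split=> // S' [splS' subS']; apply/setP => X; apply/idP/idP.
  by move/(through S splS subS)/(through S' splS' subS').
by move/(through S' splS' subS')/(through S splS subS).
Qed.
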